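(* Let $D$ be a division ring, let $B = D[x_1,\dots,x_n]$ be the polynomial ring over $D$ in the $n$ commuting variables $x_1,\dots,x_n$, and let $M$ be a finitely generated right $B$-module. Let $m$ be an integer with $0 \le m \le n$ and let $B'_m = D[x_1,\dots,x_m]$ be the polynomial ring in the first $m$ variables, with $B'_0 = D$ and $B'_n = B$. Then the following conditions on $M$ are equivalent: (i) $M$ is a finitely generated $B$-module with Krull dimension $|M|_B = m$; (ii) there exists a change of variables $t_1,\dots,t_n$ of $x_1,\dots,x_n$, so that $B$ can also be expressed as a polynomial ring $B = D[t_1,\dots,t_n]$ in the new variables $t_i$ (giving an automorphism $f$ of $B$ such that $f(x_i)=t_i$ for all $i$), such that $M$ is a finitely generated non-torsion $B_m$-module, where $B_m = D[t_1,\dots,t_m]$ is the polynomial ring in the fewer $m$ variables $t_1,\dots,t_m$ (so that $f(B'_m)=B_m$). Moreover, in this case, for any integer $k$ with $m<k\le n$, $M$ is a finitely generated torsion $B_k$-module, where $B_k = D[t_1,\dots,t_k]$ is the polynomial ring in the $k$ variables $t_1,\dots,t_k$.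
   Context: Rings are associative with identity, not necessarily commutative; modules are right modules. In a polynomial ring $R[x_1,\dots,x_n]$ the variables commute with each other and with the elements of $R$; a polynomial ring in zero variables over $D$ is $D$. A change of variables $t_1,\dots,t_n$ of $x_1,\dots,x_n$ means elements $t_1,\dots,t_n$ of $B$ that commute with each other and with $D$, are algebraically independent over $D$, and satisfy $B = D[t_1,\dots,t_n]$. $|M|_B$ denotes the (right) Krull dimension of $M$ as a $B$-module in the sense of Gabriel–Rentschler. For a noetherian ring $R$, $C(0)$ denotes the set of regular elements (non-zero-divisors) of $R$. An element $y$ of an $R$-module $M$ is a torsion element if $yd=0$ for some $d\in C(0)$; $M$ is a torsion $R$-module if every element of $M$ is a torsion element, and non-torsion if it is not a torsion module. *)

(* Defs.v *)
From HB Require Import structures.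
From mathcomp Require Import all_boot all_order all_algebra.
From mathcomp Require Import mpoly.
Set Implicit Arguments.
Unset Strict Implicit.
Unset Printing Implicit Defensive.
Import GRing.Theory.
Local Open Scope ring_scope.

(* Division rings are the D : unitRingType satisfying GRing.field_axiom D
   (which does not ask for commutativity).
   A right R-module is a left module over the converse ring R^c. *)
Definition ract (R : nzRingType) (M : lmodType R^c) (y : M) (r : R) : M :=
  (r : R^c) *: y.

(* Gabriel-Rentschler deviation: dev_lt k le A says that the subset A, (pre)ordered by le, has deviation < k.
   The deviation is < 0 when A has no two distinct comparable elements; it is
   <= k when, in each descending chain of elements of A, all but finitely many
   of the factors {x in A | c i.+1 <= x <= c i} have deviation < k.
   The deviation is in general an ordinal; only its finite values are needed
   here, and the clauses for these only refer to smaller finite ordinals. *)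
Fixpoint dev_lt (k : nat) (T : Type) (le : T -> T -> Prop) (A : T -> Prop)
    : Prop :=
  if k is j.+1 then
    forall c : nat -> T,
      (forall i, A (c i)) -> (forall i, le (c i.+1) (c i)) ->
      exists i0 : nat, forall i, (i0 <= i)%N ->
        dev_lt j le (fun x => [/\ A x, le (c i.+1) x & le x (c i)])
  else
    forall a b, A a -> A b -> le a b -> le b a.

Definition has_dev (k : nat) (T : Type) (le : T -> T -> Prop) (A : T -> Prop) :=
  dev_lt k.+1 le A /\ ~ dev_lt k le A.

Definition submodule (R : nzRingType) (M : lmodType R^c) (N : M -> Prop) :=
  [/\ N 0,
      forall y z, N y -> N z -> N (y + z)
    & forall y r, N y -> N (ract y r)].

Definition sub_le (T : Type) (N1 N2 : T -> Prop) := forall y, N1 y -> N2 y.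

(* |M|_R = k, for k a natural number (so that M is nonzero). *)
Definition krull_dim_eq (R : nzRingType) (M : lmodType R^c) (k : nat) :=
  has_dev k (@sub_le M) (@submodule R M).

Definition fin_gen_over (R : nzRingType) (S : R -> Prop) (M : lmodType R^c) :=
  exists gs : seq M, forall y : M,
    exists r : 'I_(size gs) -> R,
      (forall i, S (r i)) /\ y = \sum_(i < size gs) ract (gs`_i) (r i).

Definition fin_gen (R : nzRingType) (M : lmodType R^c) :=
  fin_gen_over (fun _ : R => True) M.

(* d lies in the set C(0) of the ring S. *)
Definition regular_in (R : nzRingType) (S : R -> Prop) (d : R) :=
  S d /\ forall b, S b -> (d * b = 0 -> b = 0) /\ (b * d = 0 -> b = 0).

Definition torsion_over (R : nzRingType) (S : R -> Prop) (M : lmodType R^c) :=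
  forall y : M, exists2 d, regular_in S d & ract y d = 0.

(* The value at t of a polynomial p in k variables with coefficients in D,
   that is, \sum_a p_a t^a. *)
Definition peval (D : nzRingType) (n k : nat) (t : 'I_k -> {mpoly D[n]})
    (p : {mpoly D[k]}) : {mpoly D[n]} :=
  mmap (@mpolyC n D) t p.

Definition change_of_variables (D : nzRingType) (n : nat)
    (t : 'I_n -> {mpoly D[n]}) :=
  [/\ forall i j, GRing.comm (t i) (t j),
      forall i (c : D), GRing.comm (t i) c%:MP,
      forall p : {mpoly D[n]}, peval t p = 0 -> p = 0
    & forall b : {mpoly D[n]}, exists p : {mpoly D[n]}, b = peval t p].

(* The subring D[t_1, ..., t_k] of D[x_1, ..., x_n], for k <= n. *)
Definition first_vars (D : nzRingType) (n : nat) (t : 'I_n -> {mpoly D[n]})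
    (k : nat) (kn : (k <= n)%N) (b : {mpoly D[n]}) : Prop :=
  exists p : {mpoly D[k]}, b = peval (fun i : 'I_k => t (widen_ord kn i)) p.

(* These conditions determine f when t is a change of variables. *)
Definition change_automorphism (D : nzRingType) (n : nat)
    (t : 'I_n -> {mpoly D[n]}) (f : {rmorphism {mpoly D[n]} -> {mpoly D[n]}}) :=
  [/\ bijective f,
      forall c : D, f c%:MP = c%:MP
    & forall i : 'I_n, f 'X_i = t i].

(* Main.v *)
(** Nagata's shears x_i -> x_i + x_k^(E^(k-i)) only involve central coefficients,
so Noether normalization works over a division ring: after an automorphism of B
fixing D, the module M becomes finitely generated and not torsion over
D[x_1..x_k] for some k (or M = 0).  It then remains to see that |M|_B = k.

Upper bound: sending a submodule over D[x_1..x_k] to its set of leading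
monomials is strictly increasing, and a set of monomials of the form "upper set
minus upper set" that contains no d-dimensional box a + N^J has deviation < d,
by Dickson's lemma.

Lower bound: in the chain of the B-submodules M x_k^e, each factor is again
finitely generated and not torsion over D[x_1..x_(k-1)].  This, and the torsion
over more variables, come from the fact that s+1 vectors in D[x_1..x_k]^s are
linearly dependent, D[x_1..x_k] being an Ore domain. *)

Require Import Defs.
From HB Require Import structures.
From mathcomp Require Import all_boot all_order all_algebra.
From mathcomp Require Import mpoly.
From Stdlib Require Import Classical ClassicalEpsilon.
Set Implicit Arguments.
Unset Strict Implicit.
Unset Printing Implicit Defensive.
Import Order.TTheory GRing.Theory.
Local Open Scope ring_scope.

(** * Infinite sets of indices and Dickson's lemma *)

(** What survives is that the variables are central: this makes evaluation at sheared variables a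
    ring morphism. The module itself is never rebuilt. A change of variables is an automorphism f of
    B, and M is studied under the action y, b -> y f(b) over the fixed subrings D[x_1..x_k]; as f is
    bijective, the B-submodules stay the same. Deviation speaks of arbitrary descending chains, and
    boxes measure the size of a set of monomials in a way that passes directly to the factors of
    such chains. *)

Definition infinitely (I : nat -> Prop) := forall N, exists2 i, (N <= i)%N & I i.

Lemma infinitely_pigeonhole (I : nat -> Prop) (F : finType) (f : nat -> F) :
  infinitely I -> exists v, infinitely (fun i => I i /\ f i = v).
Proof.
move=> infI; apply: NNPP => noV.
have bounded v : exists N, forall i, (N <= i)%N -> I i -> f i <> v.
  apply: NNPP => noN; apply: noV; exists v => N.
  apply: NNPP => noi; apply: noN; exists N => i Ni Ii fi.
  by apply: noi; exists i.
have [N NP] := fin_all_exists bounded.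
have [i Ni Ii] := infI (\max_v N v).
exact: (NP (f i) i (leq_trans (leq_bigmax (f i)) Ni) Ii erefl).
Qed.

(* The indices at which u attains its minimum over the rest of I are already
   infinitely many, so no case distinction on boundedness is needed. *)
Lemma infinitely_monotone (I : nat -> Prop) (u : nat -> nat) :
  infinitely I ->
  exists I' : nat -> Prop, [/\ infinitely I', forall i, I' i -> I i
    & forall i j, I' i -> I' j -> (i <= j)%N -> (u i <= u j)%N].
Proof.
move=> infI.
exists (fun i => I i /\ forall j, I j -> (i <= j)%N -> (u i <= u j)%N).
split=> [N|i []//|i j [_ mini] [Ij _]]; last exact: mini.
apply: NNPP => nomin.
have none v i : (N <= i)%N -> I i -> u i = v -> False.
  elim/ltn_ind: v i => v IH i Ni Ii ui.
  apply: nomin; exists i => //; split=> // j Ij ij.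
  rewrite leqNgt; apply/negP => ltu.
  by apply: (IH (u j) _ j) => //; [rewrite -ui | exact: leq_trans ij].
by have [i Ni Ii] := infI N; exact: (none (u i) i).
Qed.

Lemma infinitely_monotone_mnm n (I : nat -> Prop) (a : nat -> 'X_{1..n}) :
  infinitely I ->
  exists I' : nat -> Prop, [/\ infinitely I', forall i, I' i -> I i
    & forall i j, I' i -> I' j -> (i <= j)%N ->
        forall l, (a i l <= a j l)%N].
Proof.
move=> infI.
suff [I' [infI' sub mono]] : exists I' : nat -> Prop,
    [/\ infinitely I', forall i, I' i -> I i
    & forall l, l \in enum 'I_n -> forall i j, I' i -> I' j -> (i <= j)%N ->
        (a i l <= a j l)%N].
  by exists I'; split=> // i j *; apply: mono => //; rewrite mem_enum.
elim: (enum 'I_n) => [|l r [I' [infI' sub mono]]]; first by exists I.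
have [I2 [infI2 sub2 mono2]] := infinitely_monotone (fun i => a i l) infI'.
exists I2; split=> // [i /sub2 /sub//|l'].
rewrite inE => /orP[/eqP->|l'r] i j I2i I2j; first exact: mono2.
by apply: mono => //; exact: sub2.
Qed.

(** The finite label [p] stands for a position in a free module, so this is Dickson's lemma for the
    monomials of a free module of finite rank. *)
Lemma dickson n (T : finType) (p : nat -> T) (a : nat -> 'X_{1..n}) :
  exists i j, [/\ (i < j)%N, p i = p j & (a i <= a j)%MM].
Proof.
have infT : infinitely (fun=> True) by move=> N; exists N.
have [v infv] := infinitely_pigeonhole p infT.
have [I [infI sub mono]] := infinitely_monotone_mnm a infv.
have [i _ Ii] := infI 0; have [j ij Ij] := infI i.+1.
exists i, j; split=> //; first by rewrite (sub _ Ii).2 (sub _ Ij).2.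
by apply/mnm_lepP; apply: mono => //; exact: ltnW.
Qed.

(** * Boxes in sets of monomials *)

Section Boxes.
Variables (n : nat) (T : finType).
Implicit Types (P Q : T -> 'X_{1..n} -> Prop) (a b : 'X_{1..n}).

(** The number of variables stays fixed at [n]: monomials in the first [k] variables are cut out by
    a predicate, so that all the rings D[x_1..x_k] share one type. *)
Definition mnm_in (k : nat) a := forall i : 'I_n, (k <= i)%N -> a i = 0%N.

Definition upset k P :=
  forall p a b, P p a -> (a <= b)%MM -> mnm_in k b -> P p b.

Definition has_box (d : nat) P :=
  exists p a (J : {set 'I_n}), #|J| = d /\
    forall b, (a <= b)%MM -> (forall i, i \notin J -> b i = a i) -> P p b.

Lemma has_box0 P p a : P p a -> has_box 0 P.
Proof.
move=> Ppa; exists p, a, set0; rewrite cards0; split=> // b _ eqb.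
by suff -> : b = a by []; apply/mnmP => i; apply: eqb; rewrite inE.
Qed.

(** One step from the base point along a direction of [J] stays in the box and makes that exponent
    nonzero; hence every direction of [J] is below [k]. *)
Lemma has_box_bound d k P :
  (forall p a, P p a -> mnm_in k a) -> has_box d P -> (d <= k)%N.
Proof.
move=> inP [p [a [J [<- box]]]].
have Jk (i : 'I_n) : i \in J -> (i < k)%N.
  move=> iJ; rewrite ltnNge; apply/negP => ki.
  have Pp : P p (a + U_(i))%MM.
    apply: box => [|j jJ]; first exact: lem_addr.
    rewrite mnmDE mnm1E; case: eqP => [eij|_]; last by rewrite addn0.
    by rewrite -eij iJ in jJ.
  by move: (inP _ _ Pp i ki); rewrite mnmDE mnm1E eqxx addn1.
case: (posnP k) => [k0|k_gt0].
  have -> : J = set0; last by rewrite cards0.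
  by apply/setP => i; rewrite inE; apply/negP => /Jk; rewrite k0.
case: k Jk k_gt0 {inP} => // k Jk _.
have inj : {in J &, injective (fun i : 'I_n => inord i : 'I_k.+1)}.
  move=> i j iJ jJ /(congr1 val); rewrite /= !inordK ?Jk // => eij.
  exact: val_inj.
rewrite -(card_in_imset inj); apply: leq_trans (max_card _) _.
by rewrite card_ord.
Qed.

(* Infinitely many parallel boxes in disjoint layers have base points that
   are unbounded in some further direction, along which they sweep out a box
   of one dimension more. *)
Lemma has_boxS k d (A C : T -> 'X_{1..n} -> Prop)
    (c : nat -> T -> 'X_{1..n} -> Prop) :
  upset k A -> upset k C -> (forall i, upset k (c i)) ->
  (forall p a, C p a -> mnm_in k a) ->
  (forall i p a, A p a -> c i p a) -> (forall i p a, c i p a -> C p a) ->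
  (forall i p a, c i.+1 p a -> c i p a) ->
  infinitely (fun i => has_box d (fun p a => c i p a /\ ~ c i.+1 p a)) ->
  has_box d.+1 (fun p a => C p a /\ ~ A p a).
Proof.
move=> upA upC upc inC Ac cC cS inf.
have cle i j p a : (i <= j)%N -> c j p a -> c i p a.
  by move/subnKC <-; elim: (j - i)%N => [|e IH]; rewrite ?addn0 // addnS => /cS.
pose isbox i (x : T * 'X_{1..n} * {set 'I_n}) :=
  #|x.2| = d /\ forall b, (x.1.2 <= b)%MM ->
    (forall l, l \notin x.2 -> b l = x.1.2 l) ->
    c i x.1.1 b /\ ~ c i.+1 x.1.1 b.
have chooseP i : exists x,
    has_box d (fun p a => c i p a /\ ~ c i.+1 p a) -> isbox i x.
  have [[p [a [J [Jd box]]]]|no] :=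
    classic (has_box d (fun p a => c i p a /\ ~ c i.+1 p a)).
    by exists (p, a, J).
  (* A layer without a box gets a dummy value, with a component borrowed from another layer because
     [T] might be empty. *)
  have [i0 _ [p [a _]]] := inf 0.
  by exists (p, 0%MM, set0) => /no.
pose x i := proj1_sig (constructive_indefinite_description _ (chooseP i)).
have xP i : has_box d (fun p a => c i p a /\ ~ c i.+1 p a) -> isbox i (x i).
  by rewrite /x; case: constructive_indefinite_description.
pose a i := (x i).1.2.
have [[p J] inf1] := infinitely_pigeonhole (fun i => ((x i).1.1, (x i).2)) inf.
have [I [infI sub mono]] := infinitely_monotone_mnm a inf1.
have boxI i : I i -> #|J| = d /\ forall b, (a i <= b)%MM ->
    (forall l, l \notin J -> b l = a i l) -> c i p b /\ ~ c i.+1 p b.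
  by move=> /sub [/xP bx [ep eJ]]; move: bx; rewrite /isbox /a ep eJ.
have [Jd _] : #|J| = d /\ True by have [i _ /boxI[]] := infI 0.
(* The boxes kept in [I] share their component and directions and have monotone base points. Either
   these are unbounded in a direction outside [J], or all their frozen coordinates are bounded,
   which turns out to be impossible. *)
have [[l lJ unb]|bdd] := classic (exists2 l, l \notin J &
    forall N, exists2 i, I i & (N <= a i l)%N).
  have [i0 _ Ii0] := infI 0; exists p, (a i0), (l |: J).
  rewrite cardsU1 lJ Jd add1n; split=> // b ab eqb.
  have [i1 Ii1 bi1] := unb (b l).
  have [i [Ii i0i bi]] : exists i, [/\ I i, (i0 <= i)%N & (b l <= a i l)%N].
    case: (leqP i0 i1) => [le|/ltnW le]; first by exists i1.
    by exists i0; split=> //; apply: leq_trans bi1 (mono _ _ Ii1 Ii0 le l).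
  pose y : 'X_{1..n} :=
    [multinom if t \in J then maxn (b t) (a i t) else a i t | t < n].
  have [|t tJ|cy ncy] := (boxI _ Ii).2 y.
  - apply/mnm_lepP => t; rewrite mnmE; case: ifP => // _; exact: leq_maxr.
  - by rewrite mnmE (negbTE tJ).
  have by_ : (b <= y)%MM.
    apply/mnm_lepP => t; rewrite mnmE; case: ifP => [_|/negbT tJ].
      exact: leq_maxl.
    have [->//|tl] := eqVneq t l.
    rewrite eqb; first exact: mono.
    by rewrite !inE negb_or tl.
  have iny := inC _ _ (cC _ _ _ cy).
  have inb : mnm_in k b.
    move=> t kt; apply/eqP; rewrite -leqn0 -(iny t kt).
    by move/mnm_lepP: by_; apply.
  split; last by move=> Ab; apply/ncy/Ac/(upA _ _ _ Ab).
  have [|//|ca _] := (boxI _ Ii0).2 (a i0); first exact: lepm_refl.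
  by apply: upC ab inb; apply: cC ca.
have bound l : exists K, l \notin J -> forall i, I i -> (a i l <= K)%N.
  have [lJ|lJ] := boolP (l \in J); first by exists 0%N.
  apply: NNPP => noK; apply: bdd; exists l => // N; apply: NNPP => noi.
  apply: noK; exists N => _ i Ii; case: leqP => // Na.
  by case: noi; exists i => //; exact: ltnW.
have [K KP] := fin_all_exists bound.
(* Coordinates in [J] are masked by [ord0], so that a repeated value of [f] means two base points
   that agree outside [J]. *)
pose f i : {ffun 'I_n -> 'I_(\max_l K l).+1} :=
  [ffun l => if l \in J then ord0 else inord (a i l)].
have [v infv] := infinitely_pigeonhole f infI.
have [i _ [Ii fi]] := infv 0; have [j ij [Ij fj]] := infv i.+1.
have eqa l : l \notin J -> a j l = a i l.
  move=> lJ; have : f i l = f j l by rewrite fi fj.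
  rewrite !ffunE (negbTE lJ) => /(congr1 val) /=.
  have lt i1 : I i1 -> (a i1 l < (\max_l K l).+1)%N.
    by move=> Ii1; rewrite ltnS (leq_trans (KP _ lJ _ Ii1)) ?leq_bigmax.
  by rewrite !inordK ?lt.
(* The join of these two base points lies in both boxes, whereas the layers [i] and [j] are
   disjoint. *)
pose y := mlcm (a i) (a j).
have [| |_ ncy] := (boxI _ Ii).2 y.
- exact: lem_mlcml.
- by move=> l lJ; rewrite mnmE eqa // maxnn.
have [| |cy _] := (boxI _ Ij).2 y.
- exact: lem_mlcmr.
- by move=> l lJ; rewrite mnmE eqa // maxnn.
by case: ncy; apply: cle cy.
Qed.

End Boxes.

(** * Deviation *)

Lemma dev_lt_sub k (T : Type) (le : T -> T -> Prop) (A A' : T -> Prop) :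
  (forall x, A x -> A' x) -> dev_lt k le A' -> dev_lt k le A.
Proof.
elim: k A A' => [|k IH] A A' sub /= dev; first by move=> a b /sub + /sub; exact: dev.
move=> c Ac dec; have [i0 i0P] := dev c (fun i => sub _ (Ac i)) dec.
exists i0 => i /i0P; apply: IH => x [Ax le1 le2]; split=> //; exact: sub.
Qed.

Lemma dev_lt_leq k k' (T : Type) (le : T -> T -> Prop) (A : T -> Prop) :
  (k <= k')%N -> dev_lt k le A -> dev_lt k' le A.
Proof.
move/subnKC <-; elim: (k' - k)%N => [|e IH]; rewrite ?addn0 // addnS => /IH.
move: (k + e)%N => {IH e} j; elim: j A => [|j IH] A devA c Ac dec.
  by exists 0%N => i _; apply: dev_lt_sub devA => x [].
have [i0 i0P] := devA c Ac dec; exists i0 => i /i0P; exact: IH.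
Qed.

Lemma has_dev_inj k k' (T : Type) (le : T -> T -> Prop) (A : T -> Prop) :
  has_dev k le A -> has_dev k' le A -> k = k'.
Proof.
move=> [lt1 nlt1] [lt2 nlt2]; case: (ltngtP k k') => // lt.
- by case: nlt2; exact: dev_lt_leq lt1.
- by case: nlt1; exact: dev_lt_leq lt2.
Qed.

(** * Right actions and polynomials in the first variables *)

(** An unbundled action can be twisted by an automorphism of the ring, and specialized to the ring
    acting on itself, without building new module structures. *)
Record right_action (R : nzRingType) (M : zmodType) (act : M -> R -> M) : Prop :=
  RightAction {
    actDl : forall y z r, act (y + z) r = act y r + act z r;
    actDr : forall y r s, act y (r + s) = act y r + act y s;
    actM : forall y r s, act y (r * s) = act (act y r) s;
    act1 : forall y, act y 1 = y }.

Section RightActionTheory.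
Variables (R : nzRingType) (M : zmodType) (act : M -> R -> M).
Hypothesis actP : right_action act.

Lemma act0l r : act 0 r = 0.
Proof. by apply: (addrI (act 0 r)); rewrite -(actDl actP) !addr0. Qed.

Lemma act0r y : act y 0 = 0.
Proof. by apply: (addrI (act y 0)); rewrite -(actDr actP) !addr0. Qed.

Lemma actNl y r : act (- y) r = - act y r.
Proof. by apply: (addrI (act y r)); rewrite -(actDl actP) !subrr act0l. Qed.

Lemma actNr y r : act y (- r) = - act y r.
Proof. by apply: (addrI (act y r)); rewrite -(actDr actP) !subrr act0r. Qed.

Lemma act_suml (I : Type) (s : seq I) (P : pred I) (F : I -> M) r :
  act (\sum_(i <- s | P i) F i) r = \sum_(i <- s | P i) act (F i) r.
Proof.
by apply: (big_morph (act^~ r)) => [x y|]; rewrite ?act0l ?(actDl actP).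
Qed.

Lemma act_sumr (I : Type) (s : seq I) (P : pred I) y (F : I -> R) :
  act y (\sum_(i <- s | P i) F i) = \sum_(i <- s | P i) act y (F i).
Proof.
by apply: (big_morph (act y)) => [r t|]; rewrite ?act0r ?(actDr actP).
Qed.

Definition submod_over (S : R -> Prop) (N : M -> Prop) :=
  [/\ N 0, forall y z, N y -> N z -> N (y + z)
    & forall y r, S r -> N y -> N (act y r)].

Definition span_over (S : R -> Prop) (I : finType) (g : I -> M) (y : M) :=
  exists r : I -> R, (forall i, S (r i)) /\ y = \sum_i act (g i) (r i).

End RightActionTheory.

Lemma right_action_mul (R : nzRingType) : right_action (@GRing.mul R).
Proof.
by split=> *; rewrite ?mulrDl ?mulrDr ?mulrA ?mulr1.
Qed.

Section PolyIn.
Variables (D : unitRingType) (n : nat).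
Implicit Types p q r : {mpoly D[n]}.

Definition poly_in (k : nat) p := forall m, m \in msupp p -> mnm_in k m.

Lemma mnm_inD k (a b : 'X_{1..n}) : mnm_in k a -> mnm_in k b -> mnm_in k (a + b)%MM.
Proof. by move=> ka kb i ki; rewrite mnmDE ka // kb. Qed.

Lemma poly_inX k a : mnm_in k a -> poly_in k ('X_[a] : {mpoly D[n]}).
Proof. by move=> ka m; rewrite msuppX mem_seq1 => /eqP->. Qed.

Lemma poly_inXi k (i : 'I_n) : (i < k)%N -> poly_in k ('X_i : {mpoly D[n]}).
Proof.
move=> ik; apply: poly_inX => j kj; rewrite mnm1E; case: eqP => // eij.
by move: kj; rewrite leqNgt -eij ik.
Qed.

Lemma poly_inC k (c : D) : poly_in k (c%:MP : {mpoly D[n]}).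
Proof.
move=> m; rewrite msuppC; case: ifP => //= _; rewrite mem_seq1 => /eqP-> i _.
by rewrite mnm0E.
Qed.

Lemma poly_in0 k : poly_in k (0 : {mpoly D[n]}).
Proof. by rewrite -mpolyC0; exact: poly_inC. Qed.

Lemma poly_in1 k : poly_in k (1 : {mpoly D[n]}).
Proof. by rewrite -mpolyC1; exact: poly_inC. Qed.

Lemma poly_inD k p q : poly_in k p -> poly_in k q -> poly_in k (p + q).
Proof. by move=> kp kq m /msuppD_le; rewrite mem_cat => /orP[/kp|/kq]. Qed.

Lemma poly_inN k p : poly_in k p -> poly_in k (- p).
Proof. by move=> kp m; rewrite (perm_mem (msuppN p)) => /kp. Qed.

Lemma poly_inB k p q : poly_in k p -> poly_in k q -> poly_in k (p - q).
Proof. by move=> kp kq; apply: poly_inD => //; exact: poly_inN. Qed.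

Lemma poly_inM k p q : poly_in k p -> poly_in k q -> poly_in k (p * q).
Proof.
move=> kp kq m /msuppM_le /allpairsP[[a b] /= [ap bq ->]].
by apply: mnm_inD; [exact: kp | exact: kq].
Qed.

Lemma poly_in_exp k p i : poly_in k p -> poly_in k (p ^+ i).
Proof.
move=> kp; elim: i => [|i IH]; first by rewrite expr0; exact: poly_in1.
by rewrite exprS; exact: poly_inM.
Qed.

Lemma poly_in_sum k (I : Type) (s : seq I) (P : pred I) (F : I -> {mpoly D[n]}) :
  (forall i, P i -> poly_in k (F i)) -> poly_in k (\sum_(i <- s | P i) F i).
Proof.
move=> kF; apply: (big_ind (poly_in k)) => //; first exact: poly_in0.
by move=> p q; exact: poly_inD.
Qed.

Lemma poly_in_leq k k' p : (k <= k')%N -> poly_in k p -> poly_in k' p.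
Proof. by move=> le kp m /kp km i k'i; apply: km; exact: leq_trans k'i. Qed.

Lemma poly_in_full k p : (n <= k)%N -> poly_in k p.
Proof. by move=> nk m _ i ki; move: (leq_trans nk ki); rewrite leqNgt ltn_ord. Qed.

Lemma poly_in_ind k (P : {mpoly D[n]} -> Prop) :
  P 0 -> (forall p q, P p -> P q -> P (p + q)) ->
  (forall (c : D) m, mnm_in k m -> P (c%:MP * 'X_[m])) ->
  forall p, poly_in k p -> P p.
Proof.
move=> P0 PD PX p kp; rewrite [p]mpolyE big_seq.
apply: (big_ind P) => // m /kp km; rewrite -mul_mpolyC; exact: PX.
Qed.

Hypothesis divD : GRing.field_axiom D.

Lemma field_axiom_mul_neq0 (c d : D) : c != 0 -> d != 0 -> c * d != 0.
Proof.
move=> c0 d0; apply: contra_neq d0 => cd0.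
by apply: (mulrI (divD c0)); rewrite cd0 mulr0.
Qed.

Lemma mleadM_div p q : p != 0 -> q != 0 -> mlead (p * q) = (mlead p + mlead q)%MM.
Proof.
by move=> p0 q0; apply: mleadM_proper; apply: field_axiom_mul_neq0; rewrite mleadc_eq0.
Qed.

Lemma mpoly_mul_neq0 p q : p != 0 -> q != 0 -> p * q != 0.
Proof.
move=> p0 q0; have pq : mleadc p * mleadc q != 0.
  by apply: field_axiom_mul_neq0; rewrite mleadc_eq0.
by rewrite -mleadc_eq0 mleadcM_proper.
Qed.

Lemma mpoly_mulI p q1 q2 : p != 0 -> p * q1 = p * q2 -> q1 = q2.
Proof.
move=> p0 /eqP; rewrite -subr_eq0 -mulrBr => pq; apply/eqP.
by rewrite -subr_eq0; apply: contraLR pq => /(mpoly_mul_neq0 p0).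
Qed.

Lemma mpolyX_neq0 a : 'X_[a] != 0 :> {mpoly D[n]}.
Proof. by rewrite -msize_poly_eq0 msizeX. Qed.

Lemma mlead_lt_sub p q : p != 0 -> mlead q = mlead p -> mleadc q = mleadc p ->
  p != q -> (mlead (p - q) < mlead p)%O.
Proof.
move=> p0 lq cq; rewrite -subr_eq0 => pq0; rewrite lt_neqAle.
apply/andP; split; last first.
  by apply: le_trans (mleadB_le _ _) _; rewrite lq leUx lexx.
by apply: contraNneq pq0 => e; rewrite -mleadc_eq0 e mcoeffB subr_eq0 -cq lq.
Qed.

(** * Leading monomials of submodules *)

Section Lead.
Variables (M : zmodType) (act : M -> {mpoly D[n]} -> M).
Hypothesis actP : right_action act.
Variables (k s : nat) (g : 'I_s -> M).
Implicit Types N : M -> Prop.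

(* Position over term: the leading term of a vector of coefficients is the
   leading monomial of its first nonzero entry. *)
Definition lead_of N (j : 'I_s) (a : 'X_{1..n}) :=
  exists r : 'I_s -> {mpoly D[n]}, [/\ forall l, poly_in k (r l),
    forall l : 'I_s, (l < j)%N -> r l = 0, r j != 0 /\ mlead (r j) = a
    & N (\sum_l act (g l) (r l))].

Lemma lead_of_in N j a : lead_of N j a -> mnm_in k a.
Proof. by case=> r [kr _ [rj <-] _]; apply: (kr j); exact: mlead_supp. Qed.

Lemma lead_of_mono N N' j a :
  (forall y, N y -> N' y) -> lead_of N j a -> lead_of N' j a.
Proof. by move=> sub [r [kr r0 rj Nr]]; exists r; split=> //; exact: sub. Qed.

Lemma lead_of_upset N : submod_over act (poly_in k) N -> upset k (lead_of N).
Proof.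
move=> [_ _ NM] j a b [r [kr r0 [rj <-] Nr]] ab kb.
have kX : poly_in k ('X_[b - mlead (r j)] : {mpoly D[n]}).
  by apply: poly_inX => i ki; rewrite mnmBE kb.
exists (fun l => r l * 'X_[b - mlead (r j)]); split.
- by move=> l; apply: poly_inM.
- by move=> l lj; rewrite r0 ?mul0r.
- rewrite mpoly_mul_neq0 ?mpolyX_neq0 // mleadM_div ?mpolyX_neq0 //.
  by rewrite mleadXm addmC submK.
- by under eq_bigr do rewrite (actM actP); rewrite -(act_suml actP); exact: NM.
Qed.

(** Reduction as for Groebner bases: from an element of [N'] one subtracts an element of [N] with
    the same leading term. The difference stays in [N'] and has a smaller leading term. *)
Lemma sub_of_lead_of N N' :
  submod_over act (poly_in k) N -> submod_over act (poly_in k) N' ->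
  (forall y, N' y -> span_over act (poly_in k) g y) ->
  (forall y, N y -> N' y) ->
  (forall j a, lead_of N' j a -> lead_of N j a) ->
  forall y, N' y -> N y.
Proof.
move=> [N0 ND NM] [N'0 N'D N'M] spN' sub subL.
(* [e] counts the last positions still allowed to be nonzero; an inner well-founded induction treats
   the leading monomial at the first of them. *)
suff main e : (e <= s)%N -> forall r : 'I_s -> {mpoly D[n]},
    (forall l, poly_in k (r l)) -> (forall l : 'I_s, (l < s - e)%N -> r l = 0) ->
    N' (\sum_l act (g l) (r l)) -> N (\sum_l act (g l) (r l)).
  move=> y N'y; have [r [kr ey]] := spN' _ N'y; rewrite ey in N'y *.
  by apply: (main s) => // l; rewrite subnn.
elim: e => [|e IHe] es r kr r0 N'r.
  rewrite big1 // => l _; rewrite r0 ?(act0r actP) // subn0; exact: ltn_ord.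
have js : (s - e.+1 < s)%N by rewrite ltn_subrL (leq_ltn_trans _ es).
pose j := Ordinal js.
have ltj (l : 'I_s) : (l < s - e)%N -> l = j \/ (l < s - e.+1)%N.
  rewrite -(subnSK es) ltnS leq_eqVlt => /orP[/eqP el|]; last by right.
  by left; exact: val_inj.
move: {2}(mlead (r j)) (erefl (mlead (r j))) => a.
elim/(ltmwf (n := n)): a r kr r0 N'r => a IHa r kr r0 N'r ea.
have [rj0|rj] := eqVneq (r j) 0.
  by apply: (IHe (ltnW es)) => // l /ltj[->|/r0].
have [r' [kr' r'0 [r'j er'] Nr']] : lead_of N j a by apply: subL; exists r.
(* Leading coefficients are matched by a right multiplication, the side on which [N] is closed. *)
pose c := (mleadc (r' j))^-1 * mleadc (r j).
have r'c : mleadc (r' j) != 0 by rewrite mleadc_eq0.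
have c0 : c != 0.
  by rewrite field_axiom_mul_neq0 ?mleadc_eq0 // invr_eq0.
pose q l := r' l * c%:MP.
have Nq : N (\sum_l act (g l) (q l)).
  under eq_bigr do rewrite (actM actP); rewrite -(act_suml actP).
  by apply: NM Nr'; exact: poly_inC.
have eN : \sum_l act (g l) (r l - q l) =
    \sum_l act (g l) (r l) - \sum_l act (g l) (q l).
  by rewrite -sumrB; apply: eq_bigr => l _; rewrite (actDr actP) (actNr actP).
have NN y : N y -> N (- y).
  move=> Ny; rewrite -(act1 actP y) -(actNr actP); apply: NM Ny.
  by apply: poly_inN; exact: poly_in1.
have kq l : poly_in k (q l) by apply: poly_inM => //; exact: poly_inC.
have q0 (l : 'I_s) : (l < j)%N -> q l = 0 by move=> lj; rewrite /q r'0 ?mul0r.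
have cC : (c%:MP : {mpoly D[n]}) != 0 by rewrite mpolyC_eq0.
have eq : mlead (q j) = mlead (r j) by rewrite mleadM_div // mleadC addm0 er'.
have ecq : mleadc (q j) = mleadc (r j).
  rewrite mleadcM_proper mleadcC; last by rewrite field_axiom_mul_neq0.
  by rewrite /c mulrA mulrV ?mul1r ?divD.
rewrite -[\sum_l _](subrK (\sum_l act (g l) (q l))) -eN.
apply: ND => //.
have kd l : poly_in k (r l - q l) by exact: poly_inB.
have d0 (l : 'I_s) : (l < s - e.+1)%N -> r l - q l = 0.
  by move=> lt; rewrite r0 // q0 // subrr.
have N'd : N' (\sum_l act (g l) (r l - q l)).
  by rewrite eN; apply: N'D => //; apply: sub; exact: NN.
(* Either the leading monomial at [j] drops, or the entry at [j] vanishes and one position fewer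
   remains. *)
have [eqj|neqj] := eqVneq (r j) (q j); last first.
  by apply: (IHa (mlead (r j - q j))) => //; rewrite -ea; exact: mlead_lt_sub.
by apply: (IHe (ltnW es)) => // l /ltj[->|/d0 //]; rewrite eqj subrr.
Qed.

End Lead.
End PolyIn.

(** * Ascending chains and the Ore condition *)

Section Noether.
Variables (D : unitRingType) (n : nat).
Hypothesis divD : GRing.field_axiom D.

Section Chain.
Variables (M : zmodType) (act : M -> {mpoly D[n]} -> M).
Hypothesis actP : right_action act.
Variables (k s : nat) (g : 'I_s -> M).

(** A chain that never stabilizes would gain a new leading monomial at every step; by Dickson's
    lemma some earlier one divides a later one in the same position, which is then not new. *)
Lemma submod_chain_stable (c : nat -> M -> Prop) :
  (forall i, submod_over act (poly_in k) (c i)) ->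
  (forall i y, c i y -> span_over act (poly_in k) g y) ->
  (forall i y, c i y -> c i.+1 y) ->
  exists i, forall y, c i.+1 y -> c i y.
Proof.
move=> subc spc incc; apply: NNPP => nostab.
have newlead i : exists x : 'I_s * 'X_{1..n},
    lead_of act k g (c i.+1) x.1 x.2 /\ ~ lead_of act k g (c i) x.1 x.2.
  apply: NNPP => nox; apply: nostab; exists i.
  apply: (sub_of_lead_of divD actP (k := k) (g := g)) (incc i) _ => //; first exact: spc.
  by move=> j a Lja; apply: NNPP => nL; apply: nox; exists (j, a).
pose x i := proj1_sig (constructive_indefinite_description _ (newlead i)).
have xP i : lead_of act k g (c i.+1) (x i).1 (x i).2 /\
    ~ lead_of act k g (c i) (x i).1 (x i).2.
  by rewrite /x; case: constructive_indefinite_description.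
have [i [j [ij ep le]]] := dickson (fun i => (x i).1) (fun i => (x i).2).
have [Li _] := xP i; have [Lj nLj] := xP j; apply: nLj.
apply: (lead_of_upset divD actP (subc j)) le (lead_of_in Lj); rewrite -ep.
apply: lead_of_mono Li => y; rewrite -(subnKC ij).
by elim: (j - i.+1)%N => [|e IH]; rewrite ?addn0 // addnS => /IH; exact: incc.
Qed.

(** [F] is an arbitrary family between [A] and [C] because the factors in the definition of
    deviation are subfamilies, on which the induction continues. For dimension 0, no box means no
    new leading monomial, so comparable members coincide. *)
Lemma dev_lt_of_no_box d (A C : M -> Prop) (F : (M -> Prop) -> Prop) :
  submod_over act (poly_in k) A -> submod_over act (poly_in k) C ->
  (forall y, C y -> span_over act (poly_in k) g y) ->
  (forall N, F N -> [/\ submod_over act (poly_in k) N, sub_le A N & sub_le N C]) ->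
  ~ has_box d (fun j a => lead_of act k g C j a /\ ~ lead_of act k g A j a) ->
  dev_lt d (@sub_le M) F.
Proof.
elim: d A C F => [|d IH] A C F subA subC spC FP nobox.
  move=> N N' /FP[subN AN NC] /FP[subN' AN' N'C] NN'.
  apply: (sub_of_lead_of divD actP (k := k) (g := g)) NN' _ => // [y /N'C|j a L']; first exact: spC.
  apply: NNPP => nL; apply: nobox; apply: has_box0; split.
    exact: lead_of_mono N'C L'.
  by move=> LA; apply: nL; exact: lead_of_mono LA.
move=> c Fc dec; apply: NNPP => noi0; apply: nobox.
have cP i := FP _ (Fc i).
apply: (@has_boxS n _ k d _ _ (fun i => lead_of act k g (c i))).
- exact: lead_of_upset.
- exact: lead_of_upset.
- by move=> i; apply: lead_of_upset => //; case: (cP i).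
- by move=> j a; exact: lead_of_in.
- by move=> i j a; apply: lead_of_mono; case: (cP i).
- by move=> i j a; apply: lead_of_mono; case: (cP i).
- by move=> i j a; apply: lead_of_mono; exact: dec.
move=> N; apply: NNPP => nobox; apply: noi0; exists N => i Ni.
have [[subi _ iC] [subi1 _ _]] := (cP i, cP i.+1).
apply: (IH (c i.+1) (c i)) => // [y /iC|N' [/FP[]]//|box]; first exact: spC.
by apply: nobox; exists i.
Qed.

(** The leading monomials involve [k] variables only, so no box has dimension k + 1. [F] is left
    free so that it can be the B-submodules, which are among the submodules over D[x_1..x_k]. *)
Lemma dev_lt_fin_gen (F : (M -> Prop) -> Prop) :
  (forall y, span_over act (poly_in k) g y) ->
  (forall N, F N -> submod_over act (poly_in k) N) ->
  dev_lt k.+1 (@sub_le M) F.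
Proof.
move=> sp FP; apply: (@dev_lt_of_no_box _ (fun y => y = 0) (fun=> True)) => //.
- by split=> // [y z -> ->|y r _ ->]; rewrite ?addr0 ?(act0l actP).
- by move=> N /FP subN; split=> // y ->; case: subN.
move=> box; suff : (k < k)%N by rewrite ltnn.
by apply: has_box_bound box => j a [L _]; exact: lead_of_in L.
Qed.

End Chain.

Implicit Types a b p q r : {mpoly D[n]}.

(* If aR and bR met only in 0, the right ideals generated by b, ab, ..., a^i b
   would increase forever. *)
Lemma poly_in_ore k a b : poly_in k a -> poly_in k b -> a != 0 ->
  exists p q, [/\ poly_in k p, poly_in k q, p != 0 & b * p = a * q].
Proof.
move=> ka kb a0.
pose c i y := exists r : nat -> {mpoly D[n]},
  (forall j, poly_in k (r j)) /\ y = \sum_(j < i) a ^+ j * b * r j.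
have kab j : poly_in k (a ^+ j * b) by apply: poly_inM => //; exact: poly_in_exp.
have [i stab] : exists i, forall y, c i.+1 y -> c i y.
  apply: (submod_chain_stable (right_action_mul _) (k := k) (g := fun _ : 'I_1 => 1)).
  - move=> i; split.
    + exists (fun=> 0); split=> [j|]; first exact: poly_in0.
      by rewrite big1 // => j _; rewrite mulr0.
    + move=> _ _ [r [kr ->]] [r' [kr' ->]]; exists (fun j => r j + r' j).
      split=> [j|]; first exact: poly_inD.
      by rewrite -big_split; apply: eq_bigr => j _; rewrite mulrDr.
    + move=> _ p kp [r [kr ->]]; exists (fun j => r j * p).
      split=> [j|]; first exact: poly_inM.
      by rewrite mulr_suml; apply: eq_bigr => j _; rewrite mulrA.
  - move=> i y [r [kr ->]]; exists (fun=> \sum_(j < i) a ^+ j * b * r j).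
    split=> [_|]; last by rewrite big_ord1 mul1r.
    by apply: poly_in_sum => j _; exact: poly_inM.
  - move=> i y [r [kr ->]]; exists (fun j => if (j < i)%N then r j else 0).
    split=> [j|]; first by case: ifP => // _; exact: poly_in0.
    rewrite big_ord_recr /= ltnn mulr0 addr0.
    by apply: eq_bigr => j _; rewrite ltn_ord.
have [|r [kr er]] := stab (a ^+ i * b).
  exists (fun j => (j == i)%:R); split=> [j|].
    by case: eqP => _; [exact: poly_in1 | exact: poly_in0].
  rewrite big_ord_recr /= eqxx mulr1 big1 ?add0r // => j _.
  by rewrite ltn_eqF ?mulr0.
(* Any nontrivial relation among the a^j b suffices: while its first coefficient is zero, [a]
   cancels on the left; once it is not, b r'_0 is a right multiple of [a]. *)
suff relP e (r' : nat -> {mpoly D[n]}) : (forall j, poly_in k (r' j)) ->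
    \sum_(j < e) a ^+ j * b * r' j = 0 -> (exists2 j, (j < e)%N & r' j != 0) ->
    exists p q, [/\ poly_in k p, poly_in k q, p != 0 & b * p = a * q].
  (* Stability writes a^i b through the earlier generators; the coefficient -1 makes this a
     nontrivial relation. *)
  apply: (relP i.+1 (fun j => if (j < i)%N then r j else -1)).
  - by move=> j; case: ifP => // _; apply: poly_inN; exact: poly_in1.
  - rewrite big_ord_recr /= ltnn mulrN1 {1}er.
    by apply/eqP; rewrite subr_eq0; apply/eqP/eq_bigr => j _; rewrite ltn_ord.
  - by exists i => //; rewrite ltnn oppr_eq0 oner_neq0.
elim: e r' => [|e IH] r' kr' rel [j]; first by rewrite ltn0.
have eS : \sum_(j < e.+1) a ^+ j * b * r' j =
    b * r' 0%N + a * \sum_(j < e) a ^+ j * b * r' j.+1.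
  rewrite big_ord_recl expr0 mul1r; congr (_ + _); rewrite mulr_sumr.
  by apply: eq_bigr => l _; rewrite exprS !mulrA.
have [r0 je r'j|r0 _ _] := eqVneq (r' 0%N) 0.
  apply: (IH (fun j => r' j.+1)) => //.
    move: rel; rewrite eS r0 mulr0 add0r => rel.
    by apply: (mpoly_mulI divD a0); rewrite rel mulr0.
  by case: j je r'j => [|j] je r'j; [rewrite r0 eqxx in r'j | exists j].
exists (r' 0%N), (- \sum_(j < e) a ^+ j * b * r' j.+1); split=> //.
  by apply: poly_inN; apply: poly_in_sum => l _; exact: poly_inM.
by apply/eqP; rewrite mulrN -addr_eq0 -eS rel.
Qed.

(** Gaussian elimination over an Ore domain: a vector with nonzero first coordinate serves as pivot,
    and common right multiples replace division by it. *)
Lemma poly_in_dependent k s t (v : 'I_t -> 'I_s -> {mpoly D[n]}) :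
  (s < t)%N -> (forall j l, poly_in k (v j l)) ->
  exists r : 'I_t -> {mpoly D[n]}, [/\ forall j, poly_in k (r j),
    exists j, r j != 0 & forall l, \sum_j v j l * r j = 0].
Proof.
elim: s t v => [|s IH] [//|t] v st kv.
  exists (fun=> 1); split=> [j||[]//]; first exact: poly_in1.
  by exists ord0; rewrite oner_neq0.
have [/existsP[j0 vj0]|] := boolP [exists j, v j ord0 != 0]; last first.
  rewrite negb_exists => /forallP v0.
  have [|r [kr r0 rel]] := IH t.+1 (fun j l => v j (lift ord0 l)) (ltnW st).
    by move=> *; exact: kv.
  exists r; split=> // l; case: (unliftP ord0 l) => [l' ->|->]; first exact: rel.
  by rewrite big1 // => j _; move: (v0 j); rewrite negbK => /eqP->; rewrite mul0r.
have [pq pqP] := fin_all_exists (fun j : 'I_t =>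
  let: ex_intro p (ex_intro q H) := poly_in_ore (kv j0 ord0) (kv (lift j0 j) ord0) vj0
  in ex_intro (fun x : {mpoly D[n]} * {mpoly D[n]} =>
    [/\ poly_in k x.1, poly_in k x.2, x.1 != 0 &
      v (lift j0 j) ord0 * x.1 = v j0 ord0 * x.2]) (p, q) H).
pose w j l := v (lift j0 j) (lift ord0 l) * (pq j).1 - v j0 (lift ord0 l) * (pq j).2.
have kw j l : poly_in k (w j l).
  by have [kp kq _ _] := pqP j; apply: poly_inB; exact: poly_inM.
have [r [kr [j1 rj1] rel]] := IH t w st kw.
(* The coefficient of the pivot [j0] collects the multiples of the pivot subtracted in [w]. *)
pose r' i := if unlift j0 i is Some j then (pq j).1 * r j else - \sum_j (pq j).2 * r j.
exists r'; split.
- move=> i; rewrite /r'; case: unliftP => [j _|_].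
    by have [kp _ _ _] := pqP j; exact: poly_inM.
  apply: poly_inN; apply: poly_in_sum => j _.
  by have [_ kq _ _] := pqP j; exact: poly_inM.
- exists (lift j0 j1); rewrite /r' liftK; have [_ _ p0 _] := pqP j1.
  exact: mpoly_mul_neq0.
move=> l; rewrite (bigD1_ord j0) //= /r' unlift_none.
under eq_bigr do rewrite liftK mulrA.
rewrite mulrN mulr_sumr addrC -sumrB.
under eq_bigr do rewrite mulrA -mulrBl.
case: (unliftP ord0 l) => [l' ->|->]; first exact: rel.
by rewrite big1 // => j _; have [_ _ _ ->] := pqP j; rewrite subrr mul0r.
Qed.

End Noether.

(** * Krull dimension *)

Section Submod.
Variables (R : nzRingType) (M : zmodType) (act : M -> R -> M).
Hypothesis actP : right_action act.
Variable N : M -> Prop.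
Hypothesis subN : submod_over act (fun=> True) N.

Lemma submod_act y r : N y -> N (act y r).
Proof. by case: subN => _ _; exact. Qed.

Lemma submodD y z : N y -> N z -> N (y + z).
Proof. by case: subN => _ + _; exact. Qed.

Lemma submodN y : N y -> N (- y).
Proof.
by move=> Ny; rewrite -(act1 actP y) -(actNr actP); exact: submod_act.
Qed.

Lemma submod_sum (I : finType) (F : I -> M) : (forall i, N (F i)) -> N (\sum_i F i).
Proof.
by move=> NF; apply: (big_ind N) => //; [case: subN | exact: submodD].
Qed.

End Submod.

Section KrullDimension.
Variables (D : unitRingType) (n : nat).
Hypothesis divD : GRing.field_axiom D.
Implicit Types p q r d : {mpoly D[n]}.

Lemma mpoly_mulXI (a : 'X_{1..n}) p q : p * 'X_[a] = q * 'X_[a] -> p = q.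
Proof.
move=> e; apply/mpolyP => m.
by rewrite -(mcoeffMX p a m) -(mcoeffMX q a m) e.
Qed.

Lemma poly_in_split k (i : 'I_n) p : i = k :> nat -> poly_in k.+1 p ->
  exists p0 p1, [/\ poly_in k p0, poly_in k.+1 p1 & p = p0 + p1 * 'X_i].
Proof.
move=> ik; move: p; apply: poly_in_ind.
- exists 0, 0; split; [exact: poly_in0 | exact: poly_in0 |].
  by rewrite mul0r addr0.
- move=> _ _ [p0 [p1 [kp0 kp1 ->]]] [q0 [q1 [kq0 kq1 ->]]].
  exists (p0 + q0), (p1 + q1); split; [exact: poly_inD | exact: poly_inD |].
  by rewrite mulrDl addrACA.
move=> c m km; have [mi0|mi] := eqVneq (m i) 0%N.
  exists (c%:MP * 'X_[m]), 0; split; last by rewrite mul0r addr0.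
    apply: poly_inM; first exact: poly_inC.
    apply: poly_inX => j; rewrite leq_eqVlt => /orP[/eqP kj|/km//].
    by have <- : i = j by apply: val_inj; rewrite /= ik.
  exact: poly_in0.
exists 0, (c%:MP * 'X_[m - U_(i)]); split; first exact: poly_in0.
  apply: poly_inM; first exact: poly_inC.
  by apply: poly_inX => j /km mj; rewrite mnmBE mj.
by rewrite add0r -mulrA -mpolyXD submK // lep1mP.
Qed.

Lemma poly_in_mulX_eq0 k (i : 'I_n) p q :
  (k <= i)%N -> poly_in k p -> p = q * 'X_i -> p = 0.
Proof.
move=> ki kp e; apply: contra_eq (erefl q) => p0.
have q0 : q != 0 by apply: contraNneq p0 => q0; rewrite e q0 mul0r.
have : mlead p \in msupp p by exact: mlead_supp.
move/kp => /(_ i ki); rewrite e mleadM_div ?mpolyX_neq0 // mleadXm mnmDE mnm1E.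
by rewrite eqxx addn1.
Qed.

(* X_i-adic descent: a solution is divisible by X_i, and the quotient is again
   a solution. *)
Lemma poly_in_descent k (i : 'I_n) s (d : 'I_s -> {mpoly D[n]})
    (b : 'I_s -> 'I_s -> {mpoly D[n]}) (r : 'I_s -> {mpoly D[n]}) :
  i = k :> nat -> (forall l, poly_in k (d l)) -> (forall l, d l != 0) ->
  (forall l, poly_in k.+1 (r l)) ->
  (forall l, d l * r l = (\sum_j b l j * r j) * 'X_i) -> forall l, r l = 0.
Proof.
move=> ik kd d0; suff main N : forall r : 'I_s -> {mpoly D[n]},
    (forall l, (msize (r l) <= N)%N) -> (forall l, poly_in k.+1 (r l)) ->
    (forall l, d l * r l = (\sum_j b l j * r j) * 'X_i) -> forall l, r l = 0.
  by apply: (main (\max_l msize (r l))%N) => l; exact: (leq_bigmax l).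
elim: N => [|N IH] {}r szr kr rel.
  by move=> l; apply/eqP; rewrite -msize_poly_eq0 -leqn0.
have [p0 p0P] := fin_all_exists (fun l => poly_in_split ik (kr l)).
have [p1 p1P] := fin_all_exists p0P.
have p00 l : p0 l = 0.
  have [k0 _ er] := p1P l; apply/eqP; apply: contraT => nz.
  (* By the equation this product is a multiple of ['X_i], yet it does not involve ['X_i]. *)
  have : d l * p0 l = 0.
    apply: (@poly_in_mulX_eq0 k i _ (\sum_j b l j * r j - d l * p1 l)).
    - by rewrite ik.
    - exact: poly_inM.
    - by rewrite mulrBl -rel er mulrDr -mulrA addrK.
  by move/eqP; rewrite (negbTE (mpoly_mul_neq0 divD (d0 l) nz)).
have er l : r l = p1 l * 'X_i by have [_ _ ->] := p1P l; rewrite p00 add0r.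
have p10 : forall l, p1 l = 0.
  apply: IH => [l|l|l].
  - have [->|nz] := eqVneq (p1 l) 0; first by rewrite msize0.
    move: (szr l); rewrite er -!mlead_deg ?mpoly_mul_neq0 ?mpolyX_neq0 //.
    by rewrite mleadM_div ?mpolyX_neq0 // mleadXm mdegD mdeg1 addn1.
  - by case: (p1P l).
  - apply: (@mpoly_mulXI U_(i)); rewrite -mulrA -er rel; congr (_ * _).
    by rewrite mulr_suml; apply: eq_bigr => j _; rewrite er mulrA.
by move=> l; rewrite er p10 mul0r.
Qed.

Lemma sum_mulX_neq0 k (i : 'I_n) s (r : 'I_s -> {mpoly D[n]}) :
  (k <= i)%N -> (forall j, poly_in k (r j)) -> (exists j, r j != 0) ->
  \sum_j r j * 'X_[U_(i) *+ j] != 0.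
Proof.
move=> ki kr [j rj]; have a_r := mlead_supp rj; set a := mlead (r j) in a_r.
apply/negP => /eqP /(congr1 (mcoeff (U_(i) *+ j + a)%MM)).
rewrite raddf_sum mcoeff0 (bigD1 j) //= mcoeffMX big1 ?addr0 => [/eqP|l lj].
  by rewrite mleadc_eq0 (negbTE rj).
apply: memN_msupp_eq0; rewrite (perm_mem (msuppMX _ _)).
apply/mapP => -[a' /kr ka' /(congr1 (fun m : 'X_{1..n} => m i))].
rewrite !mnmDE !mulmnE mnm1E eqxx !mul1n (kr _ _ a_r i ki) (ka' i ki) !addn0.
by move=> e; case/eqP: lj; exact: val_inj.
Qed.

Section Action.
Variables (M : zmodType) (act : M -> {mpoly D[n]} -> M).
Hypothesis actP : right_action act.

(** Let x be the first variable outside D[x_1..x_m]. With [s] generators, the s + 1 elements y x^j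
    for j <= s are dependent over D[x_1..x_m], and the relation is a polynomial in x that kills
    [y]. *)
Lemma torsion_of_fin_gen m k s (g : 'I_s -> M) y :
  (m < k)%N -> (k <= n)%N -> (forall y, span_over act (poly_in m) g y) ->
  exists d, [/\ poly_in k d, d != 0 & act y d = 0].
Proof.
move=> mk kn sp; pose i := Ordinal (leq_trans mk kn).
have [v vP] := fin_all_exists (fun j : 'I_s.+1 => sp (act y 'X_[U_(i) *+ j])).
have [r [kr r0 rel]] :=
  poly_in_dependent divD (ltnSn s) (fun j => let: conj kv _ := vP j in kv).
exists (\sum_j r j * 'X_[U_(i) *+ j]); split.
- apply: poly_in_sum => j _; apply: poly_inM.
    by apply: poly_in_leq (kr j); exact: ltnW.
  rewrite -mpolyXn; apply: poly_in_exp; exact: poly_inXi.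
- exact: sum_mulX_neq0 kr r0.
rewrite (act_sumr actP).
transitivity (\sum_l act (g l) (\sum_j v j l * r j)); last first.
  by rewrite big1 // => l _; rewrite rel (act0r actP).
under [RHS]eq_bigr do rewrite (act_sumr actP).
rewrite exchange_big; apply: eq_bigr => j _; have [_ ey] := vP j.
rewrite commr_mpolyX (actM actP) ey (act_suml actP).
by apply: eq_bigr => l _; rewrite (actM actP).
Qed.

(* The factors of the chain A + C t^e, where t is the last variable, are again
   finitely generated over one variable less.  They are not torsion: otherwise
   the generators of C satisfy s independent relations modulo A, and C/A is
   torsion. *)
Lemma not_dev_lt k s (g : 'I_s -> M) (A C : M -> Prop) (F : (M -> Prop) -> Prop) :
  (k <= n)%N ->
  submod_over act (fun=> True) A -> submod_over act (fun=> True) C -> sub_le A C ->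
  (forall l, C (g l)) ->
  (forall y, C y -> exists2 z, A z & span_over act (poly_in k) g (y - z)) ->
  (exists2 y, C y & forall d, poly_in k d -> d != 0 -> ~ A (act y d)) ->
  (forall N, submod_over act (fun=> True) N -> sub_le A N -> sub_le N C -> F N) ->
  ~ dev_lt k (@sub_le M) F.
Proof.
elim: k s g A C F => [|k IH] s g A C F kn subA subC AC Cg Csp [y0 Cy0 y0nt] FP dev.
  (* Deviation below 0 makes the comparable members [A] and [C] coincide, which puts [y0] into
     [A]. *)
  apply: (y0nt 1); [exact: poly_in1 | exact: oner_neq0 |].
  by rewrite (act1 actP); apply: (dev A C _ _ AC y0 Cy0); exact: FP.
pose i := Ordinal kn; pose t e : {mpoly D[n]} := 'X_[U_(i) *+ e].
have tS e : t e.+1 = 'X_i * t e by rewrite /t mulmS mpolyXD.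
have comt y r e : act (act y r) (t e) = act (act y (t e)) r.
  by rewrite -!(actM actP) commr_mpolyX.
have actB y z r : act (y - z) r = act y r - act z r.
  by rewrite (actDl actP) (actNl actP).
have kt e : poly_in k.+1 (t e).
  by rewrite /t -mpolyXn; apply: poly_in_exp; exact: poly_inXi.
pose c e y := exists z w, [/\ A z, C w & y = z + act w (t e)].
have A0 : A 0 by case: subA.
have C0 : C 0 by case: subC.
have cA e : sub_le A (c e).
  by move=> z Az; exists z, 0; rewrite (act0l actP) addr0.
have cC e : sub_le (c e) C.
  move=> _ [z [w [Az Cw ->]]]; apply: (submodD subC); first exact: AC.
  exact: (submod_act subC).
have subc e : submod_over act (fun=> True) (c e).
  split; first exact: cA.
    move=> _ _ [z [w [Az Cw ->]]] [z' [w' [Az' Cw' ->]]].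
    exists (z + z'), (w + w'); split; [exact: (submodD subA) | exact: (submodD subC) |].
    by rewrite (actDl actP) addrACA.
  move=> _ r _ [z [w [Az Cw ->]]]; exists (act z r), (act w r).
  split; [exact: (submod_act subA) | exact: (submod_act subC) |].
  by rewrite (actDl actP) comt.
have dec e : sub_le (c e.+1) (c e).
  move=> _ [z [w [Az Cw ->]]]; exists z, (act w 'X_i); split=> //.
    exact: (submod_act subC).
  by rewrite tS (actM actP).
have [e /(_ e (leqnn e))] := dev c (fun e => FP _ (subc e) (cA e) (cC e)) dec.
(* The factor is generated over D[x_1..x_k] by the g_l t^e: a coefficient splits as p0 + p1 x, with
   x the variable of index [k], and the second part falls into the next term of the chain. *)
apply: (IH s (fun l => act (g l) (t e)) _ _ _ (ltnW kn) (subc e.+1) (subc e)).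
- exact: dec.
- by move=> l; exists 0, (g l); rewrite add0r.
- move=> _ [z [w [Az Cw ->]]]; have [z' Az' [r [kr ew]]] := Csp w Cw.
  have [p0 p0P] := fin_all_exists (fun l => poly_in_split (i := i) erefl (kr l)).
  have [p1 p1P] := fin_all_exists p0P.
  exists (z + act z' (t e) + act (\sum_l act (g l) (p1 l)) (t e.+1)).
    exists (z + act z' (t e)), (\sum_l act (g l) (p1 l)); split=> //.
      by apply: (submodD subA) => //; exact: (submod_act subA).
    by apply: (submod_sum subC) => l; exact: (submod_act subC).
  exists p0; split=> [l|]; first by case: (p1P l).
  have shift (a b b' b2 : M) : a + b - (a + b' + b2) = b - b' - b2.
    by rewrite -(addrA a b') opprD addrACA subrr add0r opprD addrA.
  rewrite shift -actB ew.
  rewrite tS (actM actP) -actB (act_suml actP) -sumrB (act_suml actP).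
  apply: eq_bigr => l _; rewrite -comt; congr act.
  by have [_ _ ->] := p1P l; rewrite (actDr actP) (actM actP) addrK.
- apply: NNPP => tors.
  (* If the factor were torsion, each g_l t^e would have a multiple in A + C t^(e+1), by a nonzero
     element of D[x_1..x_k]. *)
  have relg l : exists x : {mpoly D[n]} * ('I_s -> {mpoly D[n]}),
      [/\ poly_in k x.1, x.1 != 0, forall j, poly_in k.+1 (x.2 j) &
      A (act (g l) (t e * x.1) - \sum_j act (g j) (x.2 j * t e.+1))].
    apply: NNPP => nox; apply: tors; exists (act (g l) (t e)).
      by exists 0, (g l); rewrite add0r.
    move=> d kd d0 [z [w [Az Cw ew]]]; have [z' Az' [b [kb ez]]] := Csp w Cw.
    apply: nox; exists (d, b); split=> //=.
    under eq_bigr do rewrite (actM actP); rewrite -(act_suml actP) -ez.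
    rewrite (actM actP) ew actB opprB addrACA subrr addr0.
    by apply: (submodD subA) => //; exact: (submod_act subA).
  have [x xP] := fin_all_exists relg.
  have [z0 Az0 [r0 [kr0 ey0]]] := Csp y0 Cy0.
  pose u j l := (if l == j then t e * (x j).1 else 0) - (x j).2 l * t e.+1.
  (* The coordinates of [y0] join the [s] relations, which gives s + 1 vectors of length [s]. *)
  pose v (j : 'I_s.+1) l := if unlift ord0 j is Some j' then u j' l else r0 l.
  have kv j l : poly_in k.+1 (v j l).
    rewrite /v; case: unliftP => [j' _|_ //]; have [kd _ kb _] := xP j'.
    apply: poly_inB; last exact: poly_inM.
    case: eqP => _; last exact: poly_in0.
    by apply: poly_inM => //; apply: poly_in_leq kd.
  have Au j : A (\sum_l act (g l) (u j l)).
    have [_ _ _] := xP j; congr A; rewrite /u.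
    under [RHS]eq_bigr do rewrite (actDr actP) (actNr actP).
    rewrite sumrB; congr (_ - _); rewrite (bigD1 j) //= eqxx big1 ?addr0 // => l lj.
    by rewrite (negbTE lj) (act0r actP).
  have [r [kr [j0 rj0] rel]] := poly_in_dependent divD (ltnSn s) kv.
  have {}rel l : r0 l * r ord0 + \sum_j u j l * r (lift ord0 j) = 0.
    rewrite -[RHS](rel l) big_ord_recl /v unlift_none; congr (_ + _).
    by apply: eq_bigr => j _; rewrite liftK.
  (* The relations vanish modulo [A], so a nonzero coefficient of [y0] would make it torsion modulo
     [A]. *)
  have r00 : r ord0 = 0.
    apply/eqP/negPn/negP => nz; apply: (y0nt _ (kr ord0) nz).
    rewrite -(subrK z0 y0) ey0 (actDl actP); apply: (submodD subA); last exact: (submod_act subA).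
    have -> : act (\sum_l act (g l) (r0 l)) (r ord0) =
        - \sum_j act (\sum_l act (g l) (u j l)) (r (lift ord0 j)).
      apply/eqP; rewrite -addr_eq0; apply/eqP.
      under [X in _ + X]eq_bigr do rewrite (act_suml actP).
      rewrite exchange_big (act_suml actP) -big_split big1 // => l _ /=.
      rewrite -[RHS](act0r actP (g l)) -(rel l) (actDr actP) (actM actP); congr (_ + _).
      by rewrite (act_sumr actP); apply: eq_bigr => j _; rewrite (actM actP).
    by apply: (submodN actP subA); apply: (submod_sum subA) => j; exact: (submod_act subA).
  (* After cancelling t^e, what remains is the system d_l r_l = (sum_j b_jl r_j) x, to which the
     descent applies. *)
  have rl0 : forall l, r (lift ord0 l) = 0.
    apply: (@poly_in_descent k i s (fun l => (x l).1) (fun l j => (x j).2 l)) => //.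
    - by move=> l; case: (xP l).
    - by move=> l; case: (xP l).
    move=> l; apply: (@mpoly_mulXI (U_(i) *+ e)); move: (rel l).
    rewrite r00 mulr0 add0r /u.
    under eq_bigr do rewrite mulrBl.
    rewrite sumrB (bigD1 l) //= eqxx big1 ?addr0 => [|j jl]; last first.
      by rewrite eq_sym (negbTE jl) mul0r.
    move/eqP; rewrite subr_eq0 => /eqP e1.
    rewrite commr_mpolyX mulrA e1 !mulr_suml; apply: eq_bigr => j _.
    by rewrite -!mulrA -tS commr_mpolyX.
  case/eqP: rj0; case: (unliftP ord0 j0) => [l ->|-> //]; exact: rl0.
by move=> N subN AN NC; split=> //; apply: FP => // y; [move=> /cA/AN | move=> /NC/cC].
Qed.

End Action.
End KrullDimension.

(** * Evaluation at central elements *)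

Section Evaluation.
Variables (D : nzRingType) (n k : nat) (t : 'I_k -> {mpoly D[n]}).

Definition central_family := forall i x, GRing.comm x (t i).

Lemma peval_is_zmod_morphism : zmod_morphism (peval t).
Proof. by move=> p q; rewrite /peval mmapB. Qed.

Lemma peval_is_monoid_morphism : central_family -> monoid_morphism (peval t).
Proof.
move=> ct; have [pM p1] : multiplicative (peval t); last by split.
apply: commr_mmap_is_multiplicative => [//|p m m'].
by apply: commr_prod => i _; apply: commrX; exact: ct.
Qed.

(** An alias of [peval t] that carries the proof of centrality, so that a ring morphism structure
    can be attached to it. *)
Definition central_eval of central_family := peval t.

HB.instance Definition _ (ct : central_family) :=
  GRing.isZmodMorphism.Build {mpoly D[k]} {mpoly D[n]} (central_eval ct)
    peval_is_zmod_morphism.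
HB.instance Definition _ (ct : central_family) :=
  GRing.isMonoidMorphism.Build {mpoly D[k]} {mpoly D[n]} (central_eval ct)
    (peval_is_monoid_morphism ct).

Lemma pevalC c : peval t c%:MP = c%:MP.
Proof. by rewrite /peval mmapC. Qed.

Lemma pevalX i : peval t 'X_i = t i.
Proof. by rewrite /peval mmapX mmap1U. Qed.

End Evaluation.

Lemma peval_ext (D : nzRingType) n k (t t' : 'I_k -> {mpoly D[n]}) p :
  t =1 t' -> peval t p = peval t' p.
Proof. by move=> et; apply: eq_bigr => m _; rewrite (mmap1_eq _ et). Qed.

Lemma rmorph_peval (D : nzRingType) n k (f : {rmorphism {mpoly D[n]} -> {mpoly D[n]}})
    (t : 'I_k -> {mpoly D[n]}) p :
  (forall c : D, f c%:MP = c%:MP) -> f (peval t p) = peval (f \o t) p.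
Proof.
move=> fC; rewrite rmorph_sum; apply: eq_bigr => m _; rewrite rmorphM fC.
by congr (_ * _); rewrite rmorph_prod; apply: eq_bigr => i _; rewrite rmorphXn.
Qed.

Lemma peval_id (D : nzRingType) n (p : {mpoly D[n]}) : peval (fun i => 'X_i) p = p.
Proof.
rewrite [RHS]mpolyE; apply: eq_bigr => m _.
by rewrite mmap1_id mul_mpolyC.
Qed.

Lemma rmorph_mpolyE (D : nzRingType) n
    (f : {rmorphism {mpoly D[n]} -> {mpoly D[n]}}) p :
  (forall c : D, f c%:MP = c%:MP) -> f p = peval (fun i => f 'X_i) p.
Proof. by move=> fC; rewrite -{1}[p]peval_id rmorph_peval. Qed.

(** * Noether normalization *)

(** Residues modulo [E] give the last digit, of weight 1; cancelling it and dividing by [E] leaves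
    the digits before it. *)
Lemma base_expansion_inj E k (a b : nat -> nat) :
  (forall i, (i <= k)%N -> (a i < E)%N) -> (forall i, (i <= k)%N -> (b i < E)%N) ->
  (\sum_(i < k.+1) E ^ (k - i) * a i = \sum_(i < k.+1) E ^ (k - i) * b i)%N ->
  forall i, (i <= k)%N -> a i = b i.
Proof.
elim: k => [|k IH] aE bE.
  by rewrite !big_ord1 !mul1n => e i; rewrite leqn0 => /eqP->.
have E0 : (0 < E)%N by apply: leq_ltn_trans (aE 0%N _).
have S (c : nat -> nat) : (\sum_(i < k.+2) E ^ (k.+1 - i) * c i =
    (\sum_(i < k.+1) E ^ (k - i) * c i) * E + c k.+1)%N.
  rewrite big_ord_recr /= subnn mul1n; congr (_ + _)%N.
  rewrite big_distrl; apply: eq_bigr => i _ /=.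
  by rewrite (subSn (ltnSE (ltn_ord i))) expnS -mulnA mulnC.
rewrite !S => e.
have ek : a k.+1 = b k.+1.
  by move/(congr1 (modn^~ E)): e; rewrite !modnMDl !modn_small ?aE ?bE.
move: e; rewrite ek => /addIn /eqP; rewrite eqn_pmul2r // => /eqP e i.
rewrite leq_eqVlt => /orP[/eqP->//|]; rewrite ltnS => ik.
by apply: (IH _ _ e) => // j jk; [exact/aE/leqW | exact/bE/leqW].
Qed.

Section Normalization.
Variables (D : unitRingType) (n : nat).
Hypothesis divD : GRing.field_axiom D.
Implicit Types p q d : {mpoly D[n]}.

(** * Nagata's shears and polynomials monic in one variable *)

Section Shear.
Variables (k : 'I_n) (E : nat).

(** [b] is a sign: [false] adds the power of ['X_k] and [true] subtracts it, which gives the inverse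
    since ['X_k] itself is fixed. *)
Definition shear_var (b : bool) (i : 'I_n) : {mpoly D[n]} :=
  if (i < k)%N then 'X_i + (-1) ^+ b * 'X_k ^+ (E ^ (k - i)) else 'X_i.

Lemma shear_central b : central_family (shear_var b).
Proof.
move=> i x; rewrite /shear_var; case: ifP => _; last exact: commr_mpolyX.
apply: commrD; first exact: commr_mpolyX.
by apply: commrM; [exact: commr_sign | apply: commrX; exact: commr_mpolyX].
Qed.

Definition shear b : {rmorphism {mpoly D[n]} -> {mpoly D[n]}} :=
  central_eval (shear_central b).

Lemma shearC b c : shear b c%:MP = c%:MP.
Proof. exact: pevalC. Qed.

Lemma shearX b i : shear b 'X_i = shear_var b i.
Proof. exact: pevalX. Qed.

Lemma shearK b : cancel (shear b) (shear (~~ b)).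
Proof.
move=> p; rewrite (rmorph_mpolyE p (shearC b)) rmorph_peval; last exact: shearC.
rewrite -[RHS]peval_id; apply: peval_ext => i /=.
rewrite shearX /shear_var; case: ifP => ik; last by rewrite shearX /shear_var ik.
rewrite rmorphD rmorphM rmorph_sign rmorphXn !shearX /shear_var ik ltnn.
by rewrite -addrA -mulrDl; case: b; rewrite /= ?subrr ?addNr mul0r addr0.
Qed.

Lemma shear_poly_in b p : poly_in k.+1 p -> poly_in k.+1 (shear b p).
Proof.
move: p; apply: poly_in_ind => [|p q kp kq|c m km].
- by rewrite rmorph0; exact: poly_in0.
- by rewrite rmorphD; exact: poly_inD.
rewrite rmorphM shearC; apply: poly_inM; first exact: poly_inC.
have -> : shear b 'X_[m] = mmap1 (shear_var b) m by exact: mmapX.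
apply: (big_ind (poly_in k.+1)) => [|p q|i _]; [exact: poly_in1 | exact: poly_inM |].
have [ki|ik] := ltnP k i; first by rewrite km // expr0; exact: poly_in1.
apply: poly_in_exp; rewrite /shear_var; case: ifP => _; last exact: poly_inXi.
apply: poly_inD; first exact: poly_inXi.
apply: poly_inM; apply: poly_in_exp; last exact: poly_inXi.
by apply: poly_inN; exact: poly_in1.
Qed.

Definition deg_lt N p := forall m, m \in msupp p -> (m k < N)%N.

Lemma deg_ltD N p q : deg_lt N p -> deg_lt N q -> deg_lt N (p + q).
Proof. by move=> dp dq m /msuppD_le; rewrite mem_cat => /orP[/dp|/dq]. Qed.

Lemma deg_ltN N p : deg_lt N p -> deg_lt N (- p).
Proof. by move=> dp m; rewrite (perm_mem (msuppN p)) => /dp. Qed.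

(** The hypotheses are asymmetric, degree < [a] against degree <= [b], because a strict bound on one
    factor is enough. *)
Lemma deg_ltM a b p q : deg_lt a p -> deg_lt b.+1 q -> deg_lt (a + b) (p * q).
Proof.
move=> dp dq m /msuppM_le /allpairsP[[m1 m2] /= [/dp lt1 /dq lt2 ->]].
by rewrite mnmDE -addSn leq_add.
Qed.

Lemma deg_lt_leq a b p : (a <= b)%N -> deg_lt a p -> deg_lt b p.
Proof. by move=> ab dp m /dp lt; exact: leq_trans lt ab. Qed.

Lemma deg_ltC c : deg_lt 1 (c%:MP).
Proof.
move=> m; rewrite msuppC; case: ifP => //= _; rewrite mem_seq1 => /eqP->.
by rewrite mnm0E.
Qed.

Lemma deg_lt_Xk N : deg_lt N.+1 ('X_k ^+ N).
Proof.
by move=> m; rewrite mpolyXn msuppX mem_seq1 => /eqP->; rewrite mulmnE mnm1E eqxx mul1n.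
Qed.

Definition monic_deg N p := deg_lt N (p - 'X_k ^+ N).

Lemma monic_deg_lt N p : monic_deg N p -> deg_lt N.+1 p.
Proof.
move=> mp; rewrite -(subrK ('X_k ^+ N) p); apply: deg_ltD; last exact: deg_lt_Xk.
exact: deg_lt_leq mp.
Qed.

Lemma monic_deg1 : monic_deg 0 1.
Proof. by move=> m; rewrite expr0 subrr msupp0. Qed.

Lemma monic_degM a b p q : monic_deg a p -> monic_deg b q -> monic_deg (a + b) (p * q).
Proof.
move=> mp mq; rewrite /monic_deg.
have -> : p * q - 'X_k ^+ (a + b) = (p - 'X_k ^+ a) * q + (q - 'X_k ^+ b) * 'X_k ^+ a.
  have -> : (q - 'X_k ^+ b) * 'X_k ^+ a = 'X_k ^+ a * (q - 'X_k ^+ b).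
    exact: commrX (commr_mpolyX _ _).
  by rewrite mulrBl mulrBr exprD addrA subrK.
apply: deg_ltD; first by apply: deg_ltM => //; exact: monic_deg_lt.
by rewrite addnC; apply: deg_ltM => //; exact: deg_lt_Xk.
Qed.

Lemma monic_degX a p m : monic_deg a p -> monic_deg (a * m) (p ^+ m).
Proof.
move=> mp; elim: m => [|m IH]; first by rewrite muln0 expr0; exact: monic_deg1.
by rewrite mulnS exprS; exact: monic_degM.
Qed.

(** For positive [E], this is the degree in ['X_k] that the shear gives to a monomial in the
    variables up to [k]. *)
Definition shear_weight (m : 'X_{1..n}) := (\sum_(i < n) E ^ (k - i) * m i)%N.

Lemma shear_monic m : (0 < E)%N -> mnm_in k.+1 m ->
  monic_deg (shear_weight m) (shear false 'X_[m]).
Proof.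
move=> E0 km; have -> : shear false 'X_[m] = mmap1 (shear_var false) m by exact: mmapX.
apply: (big_rec2 (fun w p => monic_deg w p)) => [|i w p _ mp]; first exact: monic_deg1.
apply: monic_degM mp; have [ki|ik] := ltnP k i.
  by rewrite km // muln0 expr0; exact: monic_deg1.
apply: monic_degX; rewrite /shear_var; have [lt|ge] := ltnP i k.
  rewrite expr0 mul1r /monic_deg addrK => m'; rewrite msuppX mem_seq1 => /eqP->.
  by rewrite mnm1E -val_eqE /= ltn_eqF // expn_gt0 E0.
have -> : i = k by apply/val_inj/eqP; rewrite eqn_leq ik ge.
by rewrite subnn /monic_deg expr1 subrr => m'; rewrite msupp0.
Qed.

Lemma shear_weight_inj m m' : mnm_in k.+1 m -> mnm_in k.+1 m' ->
  (forall i, m i < E)%N -> (forall i, m' i < E)%N ->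
  shear_weight m = shear_weight m' -> m = m'.
Proof.
have W (m1 : 'X_{1..n}) : mnm_in k.+1 m1 ->
    shear_weight m1 = (\sum_(i < k.+1) E ^ (k - i) * nth 0 m1 i)%N.
  move=> k1; rewrite (big_ord_widen n (fun i => E ^ (k - i) * nth 0 m1 i)%N) //.
  rewrite big_mkcond; apply: eq_bigr => i _; rewrite (mnm_nth 0%N).
  by case: ltnP => // ki; rewrite -(mnm_nth 0%N) k1 // muln0.
move=> km km' mE m'E; rewrite !W // => /base_expansion_inj e.
apply/mnmP => i; have [ki|ik] := ltnP k i; first by rewrite km // km'.
have lt (m1 : 'X_{1..n}) j : (forall i, m1 i < E)%N -> (j <= k)%N -> (nth 0 m1 j < E)%N.
  by move=> m1E jk; rewrite -(mnm_nth 0%N m1 (Ordinal (leq_ltn_trans jk (ltn_ord k)))).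
by rewrite !(mnm_nth 0%N); apply: e => // j; exact: lt.
Qed.

(** Exponents below [E] are digits in base [E], so distinct monomials of [d] have distinct weights
    and only one attains the largest. Its coefficient is a unit of [D], whose inverse is multiplied
    on the right. *)
Lemma shear_unit_monic d : d != 0 -> poly_in k.+1 d ->
  (forall m, m \in msupp d -> forall i, m i < E)%N ->
  exists N c, monic_deg N (shear false d * c%:MP).
Proof.
move=> d0 kd dE; pose m0 := mlead d; have m0d : m0 \in msupp d := mlead_supp d0.
have exN : exists N, has (fun m => shear_weight m == N) (msupp d).
  by exists (shear_weight m0); apply/hasP; exists m0.
have leN N : has (fun m => shear_weight m == N) (msupp d) ->
    (N <= \max_(m <- msupp d) shear_weight m)%N.
  by move=> /hasP[m md /eqP <-]; apply: leq_bigmax_seq.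
have [N /hasP[m1 m1d /eqP wN] maxN] := ex_maxnP exN leN.
have E0 : (0 < E)%N by exact: leq_ltn_trans (dE _ m1d k).
have c0 : d@_m1 != 0 by rewrite -mcoeff_msupp.
have main : deg_lt N (shear false d - (d@_m1)%:MP * 'X_k ^+ N).
  rewrite {1}[d]mpolyE rmorph_sum /= (bigD1_seq m1) ?msupp_uniq //=.
  rewrite addrAC -mul_mpolyC rmorphM shearC -mulrBr; apply: deg_ltD.
    have mon := shear_monic E0 (kd _ m1d); rewrite wN in mon.
    by move=> m; rewrite mul_mpolyC => /msuppZ_le; exact: mon.
  rewrite big_seq_cond.
  apply: (big_ind (deg_lt N)) => [m|p q|m /andP[md nm]]; first by rewrite msupp0.
    exact: deg_ltD.
  rewrite -mul_mpolyC rmorphM shearC => m'; rewrite mul_mpolyC => /msuppZ_le m'h.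
  have lt := monic_deg_lt (shear_monic E0 (kd _ md)) m'h.
  apply: leq_trans lt _; rewrite ltn_neqAle maxN ?andbT; last first.
    by apply/hasP; exists m.
  apply: contra nm => /eqP e; apply/eqP.
  apply: shear_weight_inj; rewrite ?wN //; [exact: kd | exact: kd | exact: dE | exact: dE].
exists N, (d@_m1)^-1; rewrite /monic_deg.
have -> : shear false d * (d@_m1)^-1%:MP - 'X_k ^+ N =
    (shear false d - (d@_m1)%:MP * 'X_k ^+ N) * (d@_m1)^-1%:MP.
  rewrite mulrBl; congr (_ - _); rewrite mpolyXn -mulrA -commr_mpolyX mulrA.
  by rewrite -mpolyCM divrr ?divD // mpolyC1 mul1r.
by have := deg_ltM main (@deg_ltC (d@_m1)^-1); rewrite addn0.
Qed.

End Shear.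

Lemma right_action_comp (M : zmodType) (act : M -> {mpoly D[n]} -> M)
    (f : {rmorphism {mpoly D[n]} -> {mpoly D[n]}}) :
  right_action act -> right_action (fun y b => act y (f b)).
Proof.
move=> actP; split=> [y z r|y r s|y r s|y]; first exact: actDl.
- by rewrite rmorphD (actDr actP).
- by rewrite rmorphM (actM actP).
- by rewrite rmorph1 (act1 actP).
Qed.

Lemma span_over_enum (M : zmodType) (act : M -> {mpoly D[n]} -> M)
    (S : {mpoly D[n]} -> Prop) (I : finType) (g : I -> M) y :
  span_over act S g y -> span_over act S (fun i : 'I_#|I| => g (enum_val i)) y.
Proof.
move=> [r [Sr ->]]; exists (fun i => r (enum_val i)); split=> //.
exact: (reindex _ (onW_bij _ (@enum_val_bij I))).
Qed.

(* Nagata's change of variables makes annihilators of the generators monic in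
   the last variable, whose powers of bounded degree then suffice. *)
Lemma nagata_step (M : zmodType) (act : M -> {mpoly D[n]} -> M) (k : 'I_n)
    s (g : 'I_s -> M) :
  right_action act ->
  (forall y, span_over act (poly_in k.+1) g y) ->
  (forall y, exists d, [/\ poly_in k.+1 d, d != 0 & act y d = 0]) ->
  exists f : {rmorphism {mpoly D[n]} -> {mpoly D[n]}},
    [/\ bijective f, forall c : D, f c%:MP = c%:MP &
      exists s' (g' : 'I_s' -> M),
        forall y, span_over (fun y b => act y (f b)) (poly_in k) g' y].
Proof.
move=> actP sp tors.
have [d dP] := fin_all_exists (fun l => tors (g l)).
(* [E] exceeds every exponent in every annihilator, so that one shear serves all generators. *)
pose E := (\max_l msize (d l)).+1.
have dE l m : m \in msupp (d l) -> forall i, (m i < E)%N.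
  move=> /msize_mdeg_lt lt i; rewrite ltnS; apply: leq_trans (leq_bigmax l).
  by apply: leq_trans (ltnW lt); rewrite mdegE (bigD1 i) //= leq_addr.
have [N NP] := fin_all_exists (fun l =>
  let: And3 kd d0 _ := dP l in shear_unit_monic d0 kd (@dE l)).
have [c monic] := fin_all_exists NP.
(* The action is twisted by the inverse shear [f]: what [d] kills under [act], [h d] kills under the
   twisted action, and [h] makes the chosen annihilators monic up to a unit. *)
pose f := shear k E true; pose h := shear k E false.
have hK : cancel h f by exact: (shearK k E false).
have fK : cancel f h by exact: (shearK k E true).
exists f; split; [by exists h | exact: shearC |].
pose act' y b := act y (f b); have act'P : right_action act' by exact: right_action_comp.
pose d' l := h (d l) * (c l)%:MP.
have kd' l : poly_in k.+1 (d' l).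
  by have [kd _ _] := dP l; apply: poly_inM; [exact: shear_poly_in | exact: poly_inC].
have gd' l : act' (g l) (d' l) = 0.
  have [_ _ gd] := dP l.
  by rewrite (actM act'P) /act' hK gd -/(act' 0 _) (act0l act'P).
pose B := (\max_l N l)%N.
pose G (x : 'I_s * 'I_B) := act' (g x.1) ('X_k ^+ x.2).
pose W := span_over act' (poly_in k) G.
have WD y z : W y -> W z -> W (y + z).
  move=> [r [kr ->]] [r' [kr' ->]]; exists (fun x => r x + r' x).
  split=> [x|]; first exact: poly_inD.
  by rewrite -big_split; apply: eq_bigr => x _; rewrite (actDr act'P).
have W0 : W 0.
  exists (fun=> 0); split=> [x|]; first exact: poly_in0.
  by rewrite big1 // => x _; rewrite (act0r act'P).
have WM y p : W y -> poly_in k p -> W (act' y p).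
  move=> [r [kr ->]] kp; exists (fun x => r x * p); split=> [x|].
    exact: poly_inM.
  by rewrite (act_suml act'P); apply: eq_bigr => x _; rewrite (actM act'P).
have WG x : W (G x).
  exists (fun x' => if x' == x then 1 else 0); split=> [x'|].
    by case: eqP => _; [exact: poly_in1 | exact: poly_in0].
  rewrite (bigD1 x) //= eqxx (act1 act'P) big1 ?addr0 // => x' /negbTE->.
  exact: (act0r act'P).
(* Each monomial is treated separately, its power of ['X_k] being pulled to the left and absorbed by
   [We]. *)
have lower l e b : (forall j, (j < e)%N -> W (act' (g l) ('X_k ^+ j))) ->
    poly_in k.+1 b -> deg_lt k e b -> W (act' (g l) b).
  move=> We kb eb; rewrite [b]mpolyE (act_sumr act'P) big_seq.
  apply: (big_ind W) => // m mb; rewrite -mul_mpolyC.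
  have -> : (b@_m)%:MP * 'X_[m] =
      'X_k ^+ m k * ((b@_m)%:MP * 'X_[m - U_(k) *+ m k]) :> {mpoly D[n]}.
    have le : (U_(k) *+ m k <= m)%MM.
      apply/mnm_lepP => i; rewrite mulmnE mnm1E.
      by case: eqP => [->|_]; rewrite ?mul1n ?mul0n.
    rewrite -[X in _ * 'X_[X] = _](submK le) mpolyXD mpolyXn mulrA.
    exact: commr_mpolyX.
  rewrite (actM act'P); apply: WM; first by apply: We; exact: eb.
  apply: poly_inM; first exact: poly_inC.
  apply: poly_inX => i; rewrite leq_eqVlt mnmBE mulmnE mnm1E => /orP[/eqP ki|ki].
    by have <- : k = i; [exact: val_inj | rewrite eqxx mul1n subnn].
  by rewrite (kb _ mb i ki).
have WX l e : W (act' (g l) ('X_k ^+ e)).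
  elim/ltn_ind: e => e IH; have [eB|Be] := ltnP e B.
    exact: (WG (l, Ordinal eB)).
  have Ne : (N l <= e)%N by apply: leq_trans Be; exact: (leq_bigmax l).
  (* As [d' l] kills [g l], its leading power acts on [g l] as minus its lower terms do. *)
  have -> : act' (g l) ('X_k ^+ e) =
      act' (g l) (- ((d' l - 'X_k ^+ N l) * 'X_k ^+ (e - N l))).
    rewrite mulrBl opprB -exprD subnKC // (actDr act'P) (actNr act'P) (actM act'P).
    by rewrite gd' (act0l act'P) subr0.
  have kX j : poly_in k.+1 ('X_k ^+ j : {mpoly D[n]}).
    by apply: poly_in_exp; exact: poly_inXi.
  apply: (lower l e) => //.
    by apply: poly_inN; apply: poly_inM => //; exact: poly_inB.
  apply: deg_ltN; rewrite -[X in deg_lt _ X](subnKC Ne).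
  by apply: deg_ltM; [exact: monic | exact: deg_lt_Xk].
exists #|{: 'I_s * 'I_B}|, (fun i => G (enum_val i)) => y; apply: span_over_enum.
have [r [kr ->]] := sp y; apply: (big_ind W) => // l _.
rewrite -(hK (r l)); apply: (lower l (msize (h (r l)))) => // [|m mh].
  exact: shear_poly_in.
by apply: leq_ltn_trans (msize_mdeg_lt mh); rewrite mdegE (bigD1 k) //= leq_addr.
Qed.

(** An element that is not torsion ends the search; otherwise all elements are torsion and Nagata's
    step removes a variable. Over [D] itself nonzero scalars are invertible, so torsion means
    zero. *)
Lemma noether_normalization (M : zmodType) (act : M -> {mpoly D[n]} -> M) k
    s (g : 'I_s -> M) :
  right_action act -> (k <= n)%N -> (forall y, span_over act (poly_in k) g y) ->
  (forall y : M, y = 0) \/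
  exists k' (f : {rmorphism {mpoly D[n]} -> {mpoly D[n]}}), [/\ (k' <= n)%N,
    bijective f /\ (forall c : D, f c%:MP = c%:MP),
    exists s' (g' : 'I_s' -> M),
      forall y, span_over (fun y b => act y (f b)) (poly_in k') g' y &
    exists y, forall d, poly_in k' d -> d != 0 -> act y (f d) != 0].
Proof.
elim: k act s g => [|k IH] act s g actP kn sp.
  have [[y nt]|tors] := classic (exists y, forall d, poly_in 0 d -> d != 0 -> act y d != 0).
    right; exists 0%N, idfun; split=> //; [by split=> //; exists id | by exists s, g |].
    by exists y.
  left=> y; apply: NNPP => y0; apply: tors; exists y => d kd d0.
  apply/eqP => yd; apply: y0.
  have [c ed] : exists c, d = c%:MP.
    move: d kd {d0 yd}; apply: poly_in_ind => [|_ _ [c ->] [c' ->]|c m km].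
    - by exists 0; rewrite mpolyC0.
    - by exists (c + c'); rewrite mpolyCD.
    exists c; have -> : m = 0%MM by apply/mnmP => i; rewrite km // mnm0E.
    by rewrite mpolyX0 mulr1.
  rewrite ed mpolyC_eq0 in d0; rewrite ed in yd.
  rewrite -(act1 actP y) -mpolyC1 -(divrr (divD d0)) mpolyCM (actM actP) yd.
  exact: (act0l actP).
have [[y nt]|tors] := classic (exists y, forall d, poly_in k.+1 d -> d != 0 -> act y d != 0).
  right; exists k.+1, idfun; split=> //; [by split=> //; exists id | by exists s, g |].
  by exists y.
have [|f1 [bf1 f1C [s' [g' sp']]]] := nagata_step (k := Ordinal kn) actP sp.
  move=> y; apply: NNPP => nt; apply: tors; exists y => d kd d0.
  by apply/eqP => yd; apply: nt; exists d.
have [|[k' [f2 [k'n [bf2 f2C] sp2 nt2]]]] :=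
  IH _ _ _ (right_action_comp f1 actP) (ltnW kn) sp'; first by left.
right; exists k', (f1 \o f2); split=> //.
by split=> [|c /=]; [exact: bij_comp | rewrite f2C f1C].
Qed.

End Normalization.

(** * Changes of variables *)

Section ChangeOfVariables.
Variables (D : unitRingType) (n : nat).
Hypothesis divD : GRing.field_axiom D.
Implicit Types (t : 'I_n -> {mpoly D[n]}) (f : {rmorphism {mpoly D[n]} -> {mpoly D[n]}}).

Lemma first_varsX k (kn : (k <= n)%N) b :
  first_vars (fun i => 'X_i : {mpoly D[n]}) kn b <-> poly_in k b.
Proof.
split=> [[p ->]|kb].
  apply: poly_in_sum => m _; apply: poly_inM; first exact: poly_inC.
  apply: (big_ind (poly_in k)) => [|p' q|i _]; [exact: poly_in1 | exact: poly_inM |].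
  by apply: poly_in_exp; apply: poly_inXi => /=.
move: b kb; apply: poly_in_ind.
- by exists 0; rewrite /peval mmap0.
- by move=> _ _ [p ->] [q ->]; exists (p + q); rewrite /peval mmapD.
move=> c m km; exists (c *: 'X_[[multinom m (widen_ord kn i) | i < k]]).
rewrite /peval mmapZ mmapX; congr (_ * _).
transitivity (\prod_(i < n | (i < k)%N) ('X_i : {mpoly D[n]}) ^+ m i).
  rewrite big_mkcond mpolyXE_id; apply: eq_bigr => i _.
  by case: ltnP => // /km->.
rewrite (big_ord_narrow kn).
by apply: eq_bigr => i _; rewrite mnmE.
Qed.

Lemma first_vars_rmorph t f k (kn : (k <= n)%N) b :
  (forall c : D, f c%:MP = c%:MP) -> (forall i, f 'X_i = t i) ->
  first_vars t kn b <-> exists2 a, poly_in k a & f a = b.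
Proof.
move=> fC fX.
have ev (p : {mpoly D[k]}) : f (peval (fun i => 'X_(widen_ord kn i)) p) =
    peval (fun i => t (widen_ord kn i)) p.
  by rewrite rmorph_peval //; apply: peval_ext => i /=; rewrite fX.
split=> [[p ->]|[a /first_varsX-/(_ kn)[p ->] <-]]; last by exists p; rewrite ev.
by exists (peval (fun i => 'X_(widen_ord kn i)) p); rewrite ?ev //; apply/first_varsX; exists p.
Qed.

Lemma change_of_variables_rmorph f :
  bijective f -> (forall c : D, f c%:MP = c%:MP) ->
  change_of_variables (fun i => f 'X_i).
Proof.
move=> bf fC; have injf := bij_inj bf; split.
- by move=> i j; rewrite /GRing.comm -!rmorphM commr_mpolyX.
- by move=> i c; rewrite /GRing.comm -(fC c) -!rmorphM commr_mpolyX.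
- by move=> p; rewrite -rmorph_mpolyE // => fp; apply: injf; rewrite fp rmorph0.
by move=> b; case: bf => h _ fh; exists (h b); rewrite -rmorph_mpolyE.
Qed.

(** Every element of B is a polynomial in the t_i with coefficients in [D], and the t_i commute with
    both. Centrality is what makes evaluation at [t] multiplicative. *)
Lemma change_of_variables_central t : change_of_variables t -> central_family t.
Proof.
move=> [tt tC _ surj] i x; have [p ->] := surj x; apply: commr_sym.
apply: commr_sum => m _; apply: commrM; first exact: tC.
by apply: commr_prod => j _; apply: commrX; exact: tt.
Qed.

Lemma change_of_variables_automorphism t :
  change_of_variables t -> exists f, change_automorphism t f.
Proof.
move=> ct; exists (central_eval (change_of_variables_central ct)).
case: ct (change_of_variables_central ct) => _ _ inj surj ct; split.
- pose h b := proj1_sig (constructive_indefinite_description _ (surj b)).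
  have hK b : b = peval t (h b).
    by rewrite /h; case: constructive_indefinite_description.
  exists h => [p|b]; last exact/esym/hK.
  apply/eqP; rewrite -subr_eq0; apply/eqP/inj.
  by rewrite /peval mmapB -/(peval t (h _)) -hK subrr.
- exact: pevalC.
- exact: pevalX.
Qed.

(** * The action twisted by a change of variables *)

Section RestrictedAction.
Variables (M : lmodType {mpoly D[n]}^c) (t : 'I_n -> {mpoly D[n]}).
Variable f : {rmorphism {mpoly D[n]} -> {mpoly D[n]}}.
Hypothesis tf : change_automorphism t f.
Let act (y : M) b := ract y (f b).

Lemma ract_right_action : right_action (@ract _ M).
Proof.
split=> [y z r|y r s|y r s|y]; rewrite /ract; [exact: scalerDr | exact: scalerDl | |].
  by rewrite scalerA.
exact: scale1r.
Qed.

Let actP : right_action act.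
Proof. exact: right_action_comp ract_right_action. Qed.

Lemma fin_gen_over_act k (kn : (k <= n)%N) :
  fin_gen_over (first_vars t kn) M <->
  exists s (g : 'I_s -> M), forall y, span_over act (poly_in k) g y.
Proof.
have [_ fC fX] := tf; split=> [[gs gsP]|[s [g gP]]].
  exists (size gs), (fun i => gs`_i) => y; have [r [kr ->]] := gsP y.
  have [a aP] := fin_all_exists (fun i =>
    let: ex_intro2 a ka fa := (first_vars_rmorph kn (r i) fC fX).1 (kr i)
    in ex_intro (fun a => poly_in k a /\ f a = r i) a (conj ka fa)).
  exists a; split=> [i|]; first by case: (aP i).
  by apply: eq_bigr => i _; rewrite /act; have [_ ->] := aP i.
have es : size [seq g i | i <- enum 'I_s] = s by rewrite size_map size_enum_ord.
exists [seq g i | i <- enum 'I_s] => y; have [a [ka ->]] := gP y.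
exists (fun i => f (a (cast_ord es i))); split=> [i|].
  by apply/(first_vars_rmorph kn _ fC fX); exists (a (cast_ord es i)).
rewrite (reindex (cast_ord es)) /=; last first.
  by apply: onW_bij; exists (cast_ord (esym es)); [exact: cast_ordK | exact: cast_ordKV].
apply: eq_bigr => i _; congr (ract _ _).
have lt_i : (i < s)%N := ltn_ord (cast_ord es i).
rewrite (nth_map (cast_ord es i)) ?size_enum_ord //.
by congr g; apply: val_inj; rewrite /= nth_enum_ord.
Qed.

(** The ring is a domain, so the regular elements of D[t_1..t_k] are exactly the images of the
    nonzero polynomials. *)
Lemma torsion_over_act k (kn : (k <= n)%N) :
  torsion_over (first_vars t kn) M <->
  forall y, exists d, [/\ poly_in k d, d != 0 & act y d = 0].
Proof.
have [bf fC fX] := tf; have injf := bij_inj bf.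
split=> tors y.
  have [e [/(first_vars_rmorph kn _ fC fX)[d kd fd] reg] ye] := tors y.
  exists d; split=> //; last by rewrite /act fd.
  apply/eqP => d0; have [|+ _] := reg 1.
    by apply/(first_vars_rmorph kn _ fC fX); exists 1; [exact: poly_in1 | rewrite rmorph1].
  rewrite -fd d0 rmorph0 mul0r => /(_ erefl) /eqP.
  by rewrite oner_eq0.
have [d [kd d0 yd]] := tors y; exists (f d) => //; split.
  by apply/(first_vars_rmorph kn _ fC fX); exists d.
move=> _ /(first_vars_rmorph kn _ fC fX)[a _ <-]; rewrite -!rmorphM -(rmorph0 f).
have zero : d * a == 0 \/ a * d == 0 -> a = 0.
  move=> da0; apply/eqP/negPn/negP => a0.
  by case: da0; apply/negP; exact: mpoly_mul_neq0.
by split=> /injf/eqP e; congr (f _); apply: zero; [left | right].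
Qed.

(** Twisting by the bijection [f] keeps the B-submodules, so the bounds obtained for the twisted
    action are bounds for the Krull dimension of [M]. *)
Lemma krull_dim_eq_act k s (g : 'I_s -> M) :
  (k <= n)%N -> (forall y, span_over act (poly_in k) g y) ->
  (exists y, forall d, poly_in k d -> d != 0 -> act y d != 0) ->
  krull_dim_eq M k.
Proof.
have [[h fh hf] fC fX] := tf => kn sp [y nt].
have subE N : submod_over act (fun=> True) N -> submodule N.
  by move=> [N0 ND NM]; split=> // z r Nz; rewrite -(hf r); exact: NM.
split.
  apply: (dev_lt_fin_gen divD actP sp) => N [N0 ND NM].
  by split=> // z r _ Nz; exact: NM.
apply: (not_dev_lt divD actP (g := g) (A := fun z => z = 0) (C := fun=> True)) => //.
- by split=> // [z w -> ->|z r _ ->]; rewrite ?addr0 ?(act0l actP).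
- by move=> z _; exists 0; rewrite ?subr0.
- by exists y => // d kd d0; apply/eqP; exact: nt.
by move=> N /subE.
Qed.

End RestrictedAction.
End ChangeOfVariables.

(** The zero module has deviation below 0, hence below every natural number. *)
Lemma not_krull_dim_eq0 (R : nzRingType) (M : lmodType R^c) k :
  (forall y : M, y = 0) -> ~ krull_dim_eq M k.
Proof.
move=> M0 [_]; apply; apply: (@dev_lt_leq 0) => // N N' [N0 _ _] _ _ y _.
by rewrite (M0 y).
Qed.

Theorem mainTheorem3 (D : unitRingType) (divD : GRing.field_axiom D) (n : nat)
    (M : lmodType {mpoly D[n]}^c) (fgM : fin_gen M)
    (m : nat) (mn : (m <= n)%N) :
  ((fin_gen M /\ krull_dim_eq M m)
   <->
   (exists t : 'I_n -> {mpoly D[n]},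
      [/\ change_of_variables t,
          exists f : {rmorphism {mpoly D[n]} -> {mpoly D[n]}},
            change_automorphism t f /\
            (forall b, first_vars t mn b <->
               exists2 a, first_vars (fun i => 'X_i) mn a & f a = b),
          fin_gen_over (first_vars t mn) M
        & ~ torsion_over (first_vars t mn) M]))
  /\
  (forall t : 'I_n -> {mpoly D[n]},
     change_of_variables t ->
     fin_gen_over (first_vars t mn) M ->
     ~ torsion_over (first_vars t mn) M ->
     forall (k : nat) (mk : (m < k)%N) (kn : (k <= n)%N),
       fin_gen_over (first_vars t kn) M /\
       torsion_over (first_vars t kn) M).
Proof.
have nontors t f k (kn : (k <= n)%N) : change_automorphism t f ->
    ~ torsion_over (first_vars t kn) M <->
    exists y : M, forall d, poly_in k d -> d != 0 -> ract y (f d) != 0.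
  move=> tf; rewrite (torsion_over_act divD M tf); split=> [nt|[y nt] tors].
    apply: NNPP => ny; apply: nt => y; apply: NNPP => nd; apply: ny.
    by exists y => d kd d0; apply/eqP => yd; apply: nd; exists d.
  by have [d [kd d0 yd]] := tors y; move/eqP: (nt d kd d0).
split; last first.
  move=> t ct fg nt k mk kn; have [f tf] := change_of_variables_automorphism ct.
  have [s [g gP]] := (fin_gen_over_act M tf mn).1 fg.
  split.
    apply/(fin_gen_over_act M tf); exists s, g => y; have [r [kr ->]] := gP y.
    by exists r; split=> // l; apply: poly_in_leq (kr l); exact: ltnW.
  apply/(torsion_over_act divD M tf) => y.
  exact: (torsion_of_fin_gen divD (right_action_comp f (ract_right_action M)) _ mk kn gP).
split=> [[_ dimM]|[t [ct [f [tf _]] fg nt]]]; last first.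
  split=> //; have [s [g gP]] := (fin_gen_over_act M tf mn).1 fg.
  by apply: (krull_dim_eq_act divD tf mn gP); apply/(nontors _ _ _ _ tf).
have [gs gsP] := fgM.
have gsn y : span_over (@ract _ M) (poly_in n) (fun i : 'I_(size gs) => gs`_i) y.
  have [r [_ ->]] := gsP y; exists r; split=> // i; exact: poly_in_full.
have [M0|[k [f [kn [bf fC] [s [g gP]] nt]]]] :=
  noether_normalization divD (ract_right_action M) (leqnn n) gsn.
  by case: (not_krull_dim_eq0 M0 dimM).
have tf : change_automorphism (fun i => f 'X_i) f by split.
have dimk : krull_dim_eq M k := krull_dim_eq_act divD tf kn gP nt.
(* Normalization does not prescribe how many variables survive; uniqueness of the deviation
   identifies their number with [m]. *)
have km : k = m := has_dev_inj dimk dimM.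
subst k; exists (fun i => f 'X_i); split.
- exact: change_of_variables_rmorph.
- exists f; split=> // b; rewrite (first_vars_rmorph mn b fC (fun=> erefl)).
  by split=> -[a ka fa]; exists a => //; apply/(first_varsX mn).
- by apply/(fin_gen_over_act M tf); exists s, g.
- by apply/(nontors _ _ _ _ tf).
Qed.
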